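(* For every $0\le k\le n^2$, $$R^B_k\cong\bigoplus_{S_1,S_2} R^B_{\lambda_{S_1,S_2}}$$ as $B_n$-modules, where the sum is over all subsets $S_1\subseteq[n-1]$ and $S_2\subseteq[n]$ such that $\lambda_{S_1,S_2}$ is a partition (i.e. weakly decreasing) and $2\sum_{i\in S_1} i+|S_2|=k$.
   Context: $P_n=\mathbf{Q}[x_1,\dots,x_n]$. $B_n$ is the group of signed permutations of $[-n,n]\setminus\{0\}$ ($\sigma(-a)=-\sigma(a)$), acting on $P_n$ by $\sigma(x_i)=\mathrm{sign}(\sigma(i))\,x_{|\sigma(i)|}$. $I^B_n$ is the ideal generated by polynomials without constant term that are symmetric in $x_1^2,\dots,x_n^2$; $\psi^B:P_n\to P_n/I^B_n$ is the projection and $R^B_k$ the $k$-th homogeneous component of $P_n/I^B_n$. For a monomial $m=\prod x_i^{p_i}$, $\lambda(m)$ is $(p_1,\dots,p_n)$ sorted weakly decreasingly. For a partition $\lambda$ with at most $n$ parts, $P^{\trianglelefteq}_\lambda$ (resp. $P^{\triangleleft}_\lambda$) is the span of monomials $m$ with $\lambda(m)$ dominated (resp. strictly dominated) by $\lambda$, and $R^B_\lambda:=\psi^B(P^{\trianglelefteq}_\lambda)/\psi^B(P^{\triangleleft}_\lambda)$. For $S_1\subseteq[n-1]$, $S_2\subseteq[n]$, $\lambda_{S_1,S_2}\in\mathbf{N}^n$ has $i$-th entry $2|\{j\in S_1: j\ge i\}|+\mathbf{1}_{S_2}(i)$, where $\mathbf 1_{S_2}$ is the indicator of $S_2$. *)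

(* Defs.v *)
From HB Require Import structures.
From mathcomp Require Import all_boot all_order all_algebra all_fingroup.
From mathcomp Require Import generic_quotient ring_quotient boolp mpoly.

Set Implicit Arguments.
Unset Strict Implicit.
Unset Printing Implicit Defensive.

Import GRing.Theory.

Local Open Scope ring_scope.
Local Open Scope quotient_scope.

Section LinearCombinations.
Variables (R : nzRingType) (V : lmodType R) (S : V -> Prop).

Definition span : {pred V} := fun x =>
  `[< exists2 r : seq (R * V),
        (forall c, c \in r -> S c.2) & x = \sum_(c <- r) c.1 *: c.2 >].

Lemma span_gen x : S x -> x \in span.
Proof.
move=> Sx; apply/asboolP; exists [:: (1, x)].
  by move=> c; rewrite inE => /eqP ->.
by rewrite big_seq1 scale1r.
Qed.

Lemma span_submod : submod_closed span.
Proof.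
split=> [|a x y /asboolP[r rS ->] /asboolP[s sS ->]]; apply/asboolP.
  by exists [::]; rewrite ?big_nil.
exists ([seq (a * c.1, c.2) | c <- r] ++ s).
  move=> c; rewrite mem_cat => /orP[/mapP[d dr ->]|/sS //]; exact: rS dr.
rewrite big_cat big_map scaler_sumr; congr (_ + _).
by apply: eq_bigr => c _; rewrite scalerA.
Qed.

Lemma span_min (P : {pred V}) :
  submod_closed P -> (forall x, S x -> x \in P) -> {subset span <= P}.
Proof.
case=> P0 PL SP x /asboolP[r rS ->].
elim: r rS => [|c r IH] rS; first by rewrite big_nil.
rewrite big_cons; apply: PL; first by apply/SP/rS; rewrite mem_head.
by apply: IH => d dr; apply: rS; rewrite in_cons dr orbT.
Qed.

End LinearCombinations.

Section GModules.
Variables (K : fieldType) (gT : finGroupType).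

(* In a group of permutations [s * t] means first [s], then [t]; a left module
   for the composition of functions is thus a right action of [gT]. *)
Record gModule := GModule {
  gcarrier :> lmodType K;
  gact : {action gT &-> gcarrier};
  gact_linear : forall g, linear (gact^~ g)
}.

Definition gModule_iso (M N : gModule) : Prop :=
  exists2 f : {linear M -> N},
    bijective f & forall (g : gT) (x : M), f (gact M x g) = gact N (f x) g.

Lemma gactD (M : gModule) g (x y : M) :
  gact M (x + y) g = gact M x g + gact M y g.
Proof. by have := gact_linear g 1 x y; rewrite !scale1r. Qed.

Lemma gact0 (M : gModule) g : gact M 0 g = 0.
Proof. by apply: (addrI (gact M 0 g)); rewrite -gactD !addr0. Qed.

Lemma gactZ (M : gModule) g a (x : M) : gact M (a *: x) g = a *: gact M x g.
Proof. by have := gact_linear g a x 0; rewrite gact0 !addr0. Qed.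

Lemma gactB (M : gModule) g (x y : M) :
  gact M (x - y) g = gact M x g - gact M y g.
Proof. by rewrite gactD -scaleN1r gactZ scaleN1r. Qed.

Lemma gactM (M : gModule) g h (x : M) :
  gact M x (g * h)%g = gact M (gact M x g) h.
Proof. by have [_ ->] : is_action setT (gact M) by case: (gact M). Qed.

Lemma gact1 (M : gModule) (x : M) : gact M x 1%g = x.
Proof.
have [gI _] : is_action setT (gact M) by case: (gact M).
by apply: (gI 1%g); rewrite /= -gactM mulg1.
Qed.

Record gSubmodule (M : gModule) := GSubmodule {
  gsub_pred :> {pred M};
  gsub_submod : submod_closed gsub_pred;
  gsub_stable : forall (g : gT) (x : M),
    x \in gsub_pred -> gact M x g \in gsub_pred
}.

HB.instance Definition _ M (W : gSubmodule M) :=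
  GRing.isSubmodClosed.Build K M (gsub_pred W) (gsub_submod W).

Section SpanSub.
Variables (M : gModule) (S : M -> Prop).
Hypothesis S_stable : forall g x, S x -> gact M x g \in span S.

Lemma span_stable g x : x \in span S -> gact M x g \in span S.
Proof.
move=> /(span_min (P := [pred y | gact M y g \in span S])); apply.
  have [s0 sL] := span_submod S; split=> [|a u v]; rewrite !inE.
    by rewrite gact0.
  by rewrite gactD gactZ; apply: sL.
by move=> y Sy; rewrite inE; apply: S_stable.
Qed.

Definition gspan : gSubmodule M := GSubmodule (span_submod S) span_stable.
End SpanSub.

Section Sub.
Variables (M : gModule) (U : gSubmodule M).

Record gsub_type := GSub { gsub_val : M; _ : gsub_val \in U }.

HB.instance Definition _ := [isSub for gsub_val].
HB.instance Definition _ := [Choice of gsub_type by <:].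
HB.instance Definition _ := [SubChoice_isSubZmodule of gsub_type by <:].
HB.instance Definition _ := [SubZmodule_isSubLmodule of gsub_type by <:].

Definition gsub_act (x : gsub_type) (g : gT) : gsub_type :=
  Sub (gact M (val x) g) (gsub_stable g (valP x)).

Lemma gsub_act1 : gsub_act^~ 1%g =1 id.
Proof. by move=> x; apply: val_inj; rewrite /= gact1. Qed.

Lemma gsub_actM x : act_morph gsub_act x.
Proof. by move=> g h; apply: val_inj; rewrite /= gactM. Qed.

Lemma gsub_act_linear g : linear (TotalAction gsub_act1 gsub_actM ^~ g).
Proof.
by move=> a x y; apply: val_inj; rewrite /= gactD gactZ.
Qed.

Definition gsub : gModule := GModule gsub_act_linear.
End Sub.

Section Quotient.
Variables (M : gModule) (W : gSubmodule M).

Definition gquot_type := Quotient.quot (gsub_pred W : zmodClosed M).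

HB.instance Definition _ := GRing.Zmodule.on gquot_type.
HB.instance Definition _ := EqQuotient.on gquot_type.

Definition gproj (x : M) : gquot_type := \pi_gquot_type x.

Lemma gproj_eq x y : (gproj x == gproj y) = (x - y \in W).
Proof. by rewrite [RHS]Quotient.idealrBE. Qed.

Lemma gprojB x y : gproj (x - y) = gproj x - gproj y.
Proof. by rewrite /gproj [LHS]raddfB. Qed.

Lemma gprojD x y : gproj (x + y) = gproj x + gproj y.
Proof. by rewrite /gproj [LHS]raddfD. Qed.

Lemma gproj0 : gproj 0 = 0.
Proof. by rewrite -(subrr (0 : M)) gprojB subrr. Qed.

Lemma gproj_repr (u : gquot_type) : gproj (repr u) = u.
Proof. exact: reprK. Qed.

Definition gquot_scale (a : K) (u : gquot_type) : gquot_type :=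
  gproj (a *: repr u).

Lemma gproj_scale a x : gquot_scale a (gproj x) = gproj (a *: x).
Proof.
apply/eqP; rewrite gproj_eq -scalerBr rpredZ // -gproj_eq.
by rewrite gproj_repr.
Qed.

Lemma gquot_scalerA a b u :
  gquot_scale a (gquot_scale b u) = gquot_scale (a * b) u.
Proof. by rewrite -[u]gproj_repr !gproj_scale scalerA. Qed.

Lemma gquot_scale1r : left_id 1 gquot_scale.
Proof. by move=> u; rewrite -[u]gproj_repr gproj_scale scale1r. Qed.

Lemma gquot_scalerDr : right_distributive gquot_scale +%R.
Proof.
move=> a u v; rewrite -[u]gproj_repr -[v]gproj_repr.
by rewrite -gprojD !gproj_scale -gprojD scalerDr.
Qed.

Lemma gquot_scalerDl u : {morph gquot_scale^~ u : a b / a + b}.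
Proof.
by move=> a b; rewrite -[u]gproj_repr !gproj_scale -gprojD scalerDl.
Qed.

HB.instance Definition _ := GRing.Zmodule_isLmodule.Build K gquot_type
  gquot_scalerA gquot_scale1r gquot_scalerDr gquot_scalerDl.

Definition gquot_act (u : gquot_type) (g : gT) : gquot_type :=
  gproj (gact M (repr u) g).

Lemma gproj_act x g : gquot_act (gproj x) g = gproj (gact M x g).
Proof.
apply/eqP; rewrite gproj_eq -gactB gsub_stable // -gproj_eq.
by rewrite gproj_repr.
Qed.

Lemma gquot_act1 : gquot_act^~ 1%g =1 id.
Proof. by move=> u; rewrite -[u]gproj_repr gproj_act gact1. Qed.

Lemma gquot_actM u : act_morph gquot_act u.
Proof. by move=> g h; rewrite -[u]gproj_repr !gproj_act gactM. Qed.

Lemma gprojZ a x : gproj (a *: x) = a *: gproj x.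
Proof. by rewrite -gproj_scale. Qed.

Lemma gquot_act_linear g : linear (TotalAction gquot_act1 gquot_actM ^~ g).
Proof.
move=> a u v /=; rewrite -[u]gproj_repr -[v]gproj_repr.
by rewrite -gprojZ -gprojD !gproj_act -gprojZ -gprojD gactD gactZ.
Qed.

Definition gquot : gModule := GModule gquot_act_linear.

Section Image.
Variable U : gSubmodule M.

Definition gimage_pred : {pred gquot} := fun y =>
  `[< exists2 x, x \in U & y = gproj x >].

Lemma gimage_submod : submod_closed gimage_pred.
Proof.
split=> [|a _ _ /asboolP[x xU ->] /asboolP[y yU ->]]; apply/asboolP.
  by exists 0; rewrite ?rpred0 ?gproj0.
by exists (a *: x + y); rewrite ?rpredD ?rpredZ // gprojD gprojZ.
Qed.

Lemma gimage_stable g y :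
  y \in gimage_pred -> gact gquot y g \in gimage_pred.
Proof.
move=> /asboolP[x xU ->]; apply/asboolP; exists (gact M x g).
  exact: gsub_stable.
by rewrite [LHS]gproj_act.
Qed.

Definition gimage : gSubmodule gquot := GSubmodule gimage_submod gimage_stable.
End Image.
End Quotient.

Section Subquotient.
Variables (M : gModule) (U W : gSubmodule M).

Definition grestr_pred : {pred gsub U} := fun x : gsub_type U => val x \in W.

Lemma grestrE x : (x \in grestr_pred) = (val x \in W).
Proof. by []. Qed.

Lemma grestr_submod : submod_closed grestr_pred.
Proof.
split=> [|a x y]; first exact: (rpred0 W).
by rewrite !grestrE => xW yW; apply: (rpredD (rpredZ a xW) yW).
Qed.

Lemma grestr_stable g x :
  x \in grestr_pred -> gact (gsub U) x g \in grestr_pred.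
Proof. by rewrite !grestrE; apply: gsub_stable. Qed.

(* This is U / (U :&: W), i.e., U / W when W is contained in U. *)
Definition gsubquot : gModule :=
  gquot (GSubmodule grestr_submod grestr_stable).
End Subquotient.

Section DirectSum.
Variables (I : finType) (M : I -> gModule).

Definition gsum_type := {dffun forall i : I, M i}.

HB.instance Definition _ := Choice.on gsum_type.

Implicit Types x y z : gsum_type.

Definition gsum_zero : gsum_type := finfun (fun i => 0 : M i).
Definition gsum_add x y : gsum_type := finfun (fun i => x i + y i).
Definition gsum_opp x : gsum_type := finfun (fun i => - x i).
Definition gsum_scale (a : K) x : gsum_type := finfun (fun i => a *: x i).

Lemma gsum_addA : associative gsum_add.
Proof. by move=> x y z; apply/ffunP => i; rewrite !ffunE addrA. Qed.
Lemma gsum_addC : commutative gsum_add.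
Proof. by move=> x y; apply/ffunP => i; rewrite !ffunE addrC. Qed.
Lemma gsum_add0 : left_id gsum_zero gsum_add.
Proof. by move=> x; apply/ffunP => i; rewrite !ffunE add0r. Qed.
Lemma gsum_addN : left_inverse gsum_zero gsum_opp gsum_add.
Proof. by move=> x; apply/ffunP => i; rewrite !ffunE addNr. Qed.

HB.instance Definition _ := GRing.isZmodule.Build gsum_type
  gsum_addA gsum_addC gsum_add0 gsum_addN.

Lemma gsum_scalerA a b x :
  gsum_scale a (gsum_scale b x) = gsum_scale (a * b) x.
Proof. by apply/ffunP => i; rewrite !ffunE scalerA. Qed.
Lemma gsum_scale1r : left_id 1 gsum_scale.
Proof. by move=> x; apply/ffunP => i; rewrite !ffunE scale1r. Qed.
Lemma gsum_scalerDr : right_distributive gsum_scale +%R.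
Proof. by move=> a x y; apply/ffunP => i; rewrite !ffunE scalerDr. Qed.
Lemma gsum_scalerDl x : {morph gsum_scale^~ x : a b / a + b}.
Proof. by move=> a b; apply/ffunP => i; rewrite !ffunE scalerDl. Qed.

HB.instance Definition _ := GRing.Zmodule_isLmodule.Build K gsum_type
  gsum_scalerA gsum_scale1r gsum_scalerDr gsum_scalerDl.

Definition gsum_act x (g : gT) : gsum_type :=
  finfun (fun i => gact (M i) (x i) g).

Lemma gsum_act1 : gsum_act^~ 1%g =1 id.
Proof. by move=> x; apply/ffunP => i; rewrite ffunE gact1. Qed.

Lemma gsum_actM x : act_morph gsum_act x.
Proof. by move=> g h; apply/ffunP => i; rewrite !ffunE gactM. Qed.

Lemma gsum_act_linear g : linear (TotalAction gsum_act1 gsum_actM ^~ g).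
Proof. by move=> a x y; apply/ffunP => i; rewrite !ffunE gactD gactZ. Qed.

Definition gsum : gModule := GModule gsum_act_linear.
End DirectSum.

End GModules.

Section SignedPermutations.
Variable n : nat.

(* The pair (b, i) stands for the element (-1)^b (i + 1) of [-n, n] \ {0}. *)
Definition signed := (bool * 'I_n)%type.

Definition sopp (a : signed) : signed := (~~ a.1, a.2).

Definition Bset : {set {perm signed}} :=
  [set s : {perm signed} | [forall a, s (sopp a) == sopp (s a)]].

Lemma Bset_group : group_set Bset.
Proof.
apply/group_setP; split=> [|s t].
  by rewrite inE; apply/forallP=> a; rewrite !perm1.
rewrite !inE => /forallP sP /forallP tP; apply/forallP=> a.
by rewrite !permM (eqP (sP a)) (eqP (tP _)).
Qed.

Definition Bgroup : {group {perm signed}} := Group Bset_group.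

Definition Bn : finGroupType := subg_of Bgroup.

Definition Bimg (g : Bn) (i : 'I_n) : signed := sgval g (false, i).

Lemma Bval_opp (g : Bn) a : sgval g (sopp a) = sopp (sgval g a).
Proof. by have := subgP g; rewrite inE => /forallP/(_ a)/eqP. Qed.

Lemma Bimg1 i : Bimg 1%g i = (false, i).
Proof. by rewrite /Bimg morph1 perm1. Qed.

Lemma BimgM g h i : Bimg (g * h)%g i =
  ((Bimg g i).1 (+) (Bimg h (Bimg g i).2).1, (Bimg h (Bimg g i).2).2).
Proof.
rewrite /Bimg morphM ?inE // permM; case: (sgval g (false, i)) => -[] j /=.
  by have /= := Bval_opp h (false, j); rewrite /sopp /= => ->.
by case: (sgval h _).
Qed.

Lemma Babs_inj g : injective (fun i => (Bimg g i).2).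
Proof.
move=> i j; rewrite /Bimg => e.
have [e1|e1] : sgval g (false, i) = sgval g (false, j) \/
    sgval g (false, i) = sgval g (sopp (false, j)).
- rewrite Bval_opp /sopp; case: (sgval g (false, i)) e => b i' /= ->.
  by case: (sgval g (false, j)) => b' j' /=; case: b b' => -[]; auto.
- by have [] := perm_inj e1.
- by have [] := perm_inj e1.
Qed.

Definition Babs g : {perm 'I_n} := perm (@Babs_inj g).

Local Notation P := {mpoly rat[n]}.

Definition Pact (p : P) (g : Bn) : P :=
  p \mPo [tuple (-1) ^+ (Bimg g i).1 *: 'X_((Bimg g i).2) | i < n].

Lemma Pact_linear g : linear (Pact^~ g).
Proof. by move=> a p q; rewrite /Pact linearP. Qed.

Lemma PactMm p q g : Pact (p * q) g = Pact p g * Pact q g.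
Proof. exact: rmorphM. Qed.

Lemma PactX m g : exists c : rat,
  Pact 'X_[m] g = c *: 'X_[[multinom m ((Babs g)^-1%g i) | i < n]].
Proof.
exists (\prod_(i < n) ((-1) ^+ (Bimg g i).1) ^+ m i).
rewrite /Pact comp_mpolyX; under eq_bigr do rewrite tnth_mktuple exprZn.
rewrite scaler_prod; congr (_ *: _).
rewrite (mpolyXE _ (Babs g)).
by apply: eq_bigr => i _; rewrite mnmE permK permE.
Qed.

Lemma Pact1 : Pact^~ 1%g =1 id.
Proof.
move=> p; rewrite /Pact -[RHS]comp_mpoly_id; congr (_ \mPo _).
by apply: eq_from_tnth => i; rewrite !tnth_mktuple Bimg1 expr0 scale1r.
Qed.

Lemma comp_mpolyA p (t u : n.-tuple P) :
  (p \mPo t) \mPo u = p \mPo [tuple tnth t i \mPo u | i < n].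
Proof.
rewrite !(comp_mpolyEX p) raddf_sum /=; apply: eq_bigr => m _.
rewrite linearZ /= !comp_mpolyX rmorph_prod /=; congr (_ *: _).
by apply: eq_bigr => i _; rewrite rmorphXn /= tnth_mktuple.
Qed.

Lemma PactMg p : act_morph Pact p.
Proof.
move=> g h; rewrite /Pact comp_mpolyA; congr (_ \mPo _).
apply: eq_from_tnth => i; rewrite !tnth_mktuple linearZ /= comp_mpolyXU.
by rewrite -tnth_nth tnth_mktuple BimgM /= scalerA signr_addb.
Qed.

Definition PB : gModule rat Bn :=
  @GModule rat Bn P (TotalAction Pact1 PactMg) Pact_linear.

Definition Xsq : n.-tuple P := [tuple 'X_i ^+ 2 | i < n].

Definition IB_gen (q : P) : Prop :=
  q@_0%MM = 0 /\ exists2 p : P, p \is symmetric & q = p \mPo Xsq.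

Definition IB_pred : {pred PB} := fun q : P =>
  `[< exists2 r : seq (P * P),
        (forall c, c \in r -> IB_gen c.2) & q = \sum_(c <- r) c.1 * c.2 >].

Lemma IB_submod : submod_closed IB_pred.
Proof.
split=> [|a x y /asboolP[r rS ->] /asboolP[s sS ->]]; apply/asboolP.
  by exists [::]; rewrite ?big_nil.
exists ([seq (a *: c.1, c.2) | c <- r] ++ s).
  move=> c; rewrite mem_cat => /orP[/mapP[d dr ->]|/sS //]; exact: rS dr.
rewrite big_cat big_map scaler_sumr; congr (_ + _).
by apply: eq_bigr => c _; rewrite scalerAl.
Qed.

Lemma IB_gen_fix q g : IB_gen q -> Pact q g = q.
Proof.
case=> _ [p /issymP sp ->]; rewrite -{2}(sp (Babs g)) msym_mPo.
rewrite /Pact comp_mpolyA; congr (_ \mPo _).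
apply: eq_from_tnth => i; rewrite !tnth_mktuple rmorphXn /= comp_mpolyXU.
by rewrite -tnth_nth tnth_mktuple exprZn sqrr_sign scale1r permE.
Qed.

Lemma IB_stable g q : q \in IB_pred -> gact PB q g \in IB_pred.
Proof.
move=> /asboolP[r rS ->]; apply/asboolP.
exists [seq (Pact c.1 g, c.2) | c <- r].
  by move=> d /mapP[c cr ->]; apply: (rS c cr).
rewrite /= /Pact raddf_sum big_map /=.
rewrite big_seq [RHS]big_seq; apply: eq_bigr => c cr.
by rewrite -[in RHS](IB_gen_fix g (rS c cr)); apply: PactMm.
Qed.

Definition IB : gSubmodule PB := GSubmodule IB_submod IB_stable.

Section Homogeneous.
Variable k : nat.

Definition Phomog_pred : {pred PB} := fun p : P => p \is k.-homog.

Lemma Phomog_submod : submod_closed Phomog_pred.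
Proof. exact: dhomog_submod_closed. Qed.

Lemma mdeg_perm (s : {perm 'I_n}) (m : 'X_{1..n}) :
  mdeg [multinom m (s i) | i < n] = mdeg m.
Proof.
rewrite !mdegE [RHS](reindex_inj (@perm_inj _ s)).
by apply: eq_bigr => i _; rewrite mnmE.
Qed.

Lemma Phomog_stable g p : p \in Phomog_pred -> gact PB p g \in Phomog_pred.
Proof.
move=> /dhomogP hp; change (Pact p g \is k.-homog).
rewrite [p]mpolyE /Pact raddf_sum big_seq; apply: rpred_sum => m mp /=.
rewrite linearZ /=; have [c] := PactX m g; rewrite /Pact => ->.
by do 2![apply: rpredZ]; rewrite dhomogX -(hp _ mp); apply/eqP/mdeg_perm.
Qed.

Definition Phomog : gSubmodule PB := GSubmodule Phomog_submod Phomog_stable.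
End Homogeneous.

Definition mpart (m : 'X_{1..n}) : seq nat := sort geq m.

(* Partitions with at most n parts are padded with zeros to length n. *)
Definition dominated (mu la : seq nat) : Prop :=
  sumn mu = sumn la /\ forall i, (sumn (take i mu) <= sumn (take i la))%N.

Definition sdominated (mu la : seq nat) : Prop :=
  dominated mu la /\ mu <> la.

Section PartitionSpan.
Variable D : seq nat -> Prop.

Definition monomial_in (p : PB) : Prop :=
  exists2 m : 'X_{1..n}, D (mpart m) & p = 'X_[m] :> P.

Lemma mpart_perm (s : {perm 'I_n}) (m : 'X_{1..n}) :
  mpart [multinom m (s i) | i < n] = mpart m.
Proof.
have tot : total geq by move=> x y; apply: leq_total.
have tra : transitive geq by move=> x y z yx zy; apply: leq_trans zy yx.
have ant : antisymmetric geq by move=> x y; rewrite andbC => /anti_leq.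
by apply/(perm_sortP tot tra ant)/tuple_permP; exists s.
Qed.

Lemma monomial_in_stable (g : Bn) (p : PB) :
  monomial_in p -> gact PB p g \in span monomial_in.
Proof.
case=> m Dm ->; have [c e] := PactX m g; rewrite [gact _ _ _]e.
have [_ sL] := span_submod monomial_in.
have [s0 _] := span_submod monomial_in.
rewrite -[X in X \in _]addr0; apply: sL => //; apply: span_gen.
by exists [multinom m ((Babs g)^-1%g i) | i < n]; rewrite ?mpart_perm.
Qed.

Definition Pspan : gSubmodule PB := gspan monomial_in_stable.
End PartitionSpan.

Definition RBk (k : nat) : gModule rat Bn := gsub (gimage IB (Phomog k)).

Definition RBpart (la : seq nat) : gModule rat Bn :=
  gsubquot (gimage IB (Pspan (dominated^~ la)))
           (gimage IB (Pspan (sdominated^~ la))).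

(* The subsets of [n - 1] and of [n] are shifted down by one, as is the index
   of the entries: j : 'I_n stands for j + 1. *)
Definition lambdaS (S : {set 'I_n.-1} * {set 'I_n}) : n.-tuple nat :=
  [tuple 2 * #|[set j in S.1 | (i <= j)%N]| + (i \in S.2) | i < n]%N.

Definition admissible (k : nat) (S : {set 'I_n.-1} * {set 'I_n}) : bool :=
  sorted geq (lambdaS S) && (2 * (\sum_(j in S.1) j.+1) + #|S.2| == k)%N.

End SignedPermutations.

(* Main.v *)
From HB Require Import structures.
From mathcomp Require Import all_boot all_order all_algebra all_fingroup.
From mathcomp Require Import generic_quotient boolp mpoly zify ring.
Require Import Defs.

(* A monomial [m] is reducible when, for some nonempty set [T] of variables,
   lowering the exponents in [T] by 2 keeps them in front of all the others, ties
   being broken by index.  Dividing [m] by the squares of the variables in [T]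
   and multiplying back by the elementary symmetric polynomial e_|T| of the
   squares expresses [m], modulo the ideal, through monomials that are strictly
   dominated by [m], or of the same type but with larger indices in front.  So
   irreducible monomials span the quotient compatibly with dominance.  They
   inject into pairs (permutation, parities), hence number at most 2^n n!.

   They are independent: on the orbit of (1, ..., n), which has 2^n n! points,
   positive degree invariants are constant, so a homogeneous element of the
   ideal agrees on the orbit with a polynomial of smaller degree.  By induction
   every function on the orbit is a combination of irreducible monomials, which
   are then linearly independent as functions, and an element of the ideal
   cannot be a combination of irreducible monomials of a single degree.

   The normal form thus splits R_k linearly into the types lambda(m) of
   irreducible monomials, which all have the form lambda_{S1,S2}.  Averaging
   this splitting over B_n keeps it unitriangular for the dominance order, with
   the canonical projections on the diagonal, hence bijective. *)

Set Implicit Arguments.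
Unset Strict Implicit.
Unset Printing Implicit Defensive.

Import GRing.Theory Num.Theory.

(** * Sums over sets of largest values *)

Section TopSets.
Variable T : finType.
Implicit Types (f : T -> nat) (B C : {set T}).

(** The common part cancels; values on [B :\: C] are at most the minimum over the larger set
    [C :\: B]. *)
Lemma leq_sum_top f B C : #|B| <= #|C| ->
  (forall a b, a \in C -> b \notin C -> f b <= f a) ->
  \sum_(a in B) f a <= \sum_(a in C) f a.
Proof.
move=> leBC top; rewrite (big_setID C) [leqRHS](big_setID B) /= setIC.
rewrite leq_add2l; have leD : #|B :\: C| <= #|C :\: B|.
  by rewrite -(leq_add2l #|B :&: C|) cardsID setIC cardsID.
case: (set_0Vmem (C :\: B)) => [e|[a0 a0P]].
  by move: leD; rewrite e cards0 leqn0 cards_eq0 => /eqP ->.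
case: (arg_minnP f a0P) => a aP amin.
apply: (@leq_trans (\sum_(b in B :\: C) f a)).
  apply: leq_sum => b; rewrite inE => /andP[bC _]; apply: top => //.
  by have : a \in C :\: B := aP; rewrite inE => /andP[].
apply: (@leq_trans (\sum_(b in C :\: B) f a)); last exact: leq_sum.
by rewrite !sum_nat_const leq_mul2r leD orbT.
Qed.

Lemma ltn_sum_top f B C : #|B| = #|C| -> B != C ->
  (forall a b, a \in C -> b \notin C -> f b < f a) ->
  \sum_(a in B) f a < \sum_(a in C) f a.
Proof.
move=> eBC neBC top.
(* Strictness leaves room to raise [f] by 1 outside [C], which only increases the sum over [B]. *)
have := @leq_sum_top (fun a => f a + (a \notin C)) B C.
rewrite eBC leqnn => /(_ isT) H; rewrite !big_split /= in H.
have {H} H: \sum_(i in B) f i + \sum_(i in B) (i \notin C) <=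
   \sum_(i in C) f i + \sum_(i in C) (i \notin C).
  by apply: H => a b aC bC; rewrite aC bC addn1 addn0; apply: top.
rewrite [X in _ <= _ + X]big1 ?addn0 in H; last by move=> i ->.
apply: leq_trans H; rewrite -[X in X < _]addn0 ltn_add2l lt0n.
apply: contra neBC; rewrite sum_nat_eq0 => /forallP H.
rewrite eqEcard eBC leqnn andbT; apply/subsetP => x xB.
by have := H x; rewrite xB /= eqb0 negbK.
Qed.
End TopSets.

Lemma seq_argmax (T : eqType) (f : T -> nat) (s : seq T) : s != [::] ->
  exists2 a, a \in s & forall b, b \in s -> f b <= f a.
Proof.
elim: s => // a s IHs _; have [->|/IHs[b bs bmax]] := eqVneq s [::].
  by exists a; rewrite ?mem_head // => b; rewrite inE => /eqP ->.
have [ab|ba] := leqP (f a) (f b).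
  exists b; first by rewrite inE bs orbT.
  by move=> c; rewrite inE => /orP[/eqP ->|/bmax].
exists a; first exact: mem_head.
move=> c; rewrite inE => /orP[/eqP ->//|/bmax cb].
exact: leq_trans cb (ltnW ba).
Qed.

(** * Sorted exponents, ranks of variables and irreducible monomials *)

Section Combinatorics.
Variable n : nat.
Implicit Types (m : 'X_{1..n}) (T C : {set 'I_n}).

Lemma size_mpart m : size (mpart m) = n.
Proof. by rewrite /mpart size_sort size_tuple. Qed.

Lemma sumn_mpart m : sumn (mpart m) = mdeg m.
Proof.
rewrite mdegE sumnE (perm_big m) /=; last by rewrite /mpart perm_sort.
by rewrite big_tuple; apply: eq_bigr => i _; rewrite mnm_tnth.
Qed.

Lemma sorted_mpart m : sorted geq (mpart m).
Proof. by apply: sort_sorted => x y; apply: leq_total. Qed.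

Lemma mem_mpart m v : (v \in mpart m) = [exists a, m a == v].
Proof.
rewrite /mpart mem_sort; apply/idP/existsP => [/tnthP[a ->]|[a /eqP <-]].
  by exists a; rewrite mnm_tnth.
by rewrite mnm_tnth mem_tnth.
Qed.

(** The first [#|C|] variables of a sorted enumeration form another set of largest exponents, and
    two such sets of equal size have equal sums. *)
Lemma sumn_take_mpart m C :
  (forall a b, a \in C -> b \notin C -> m b <= m a) ->
  sumn (take #|C| (mpart m)) = \sum_(a in C) m a.
Proof.
move=> topC.
pose L := sort (relpre m geq) (enum 'I_n).
have eL : mpart m = map m L.
  rewrite -sort_map /mpart; congr (sort _ _).
  by rewrite -[LHS](map_tnth_enum m); apply: eq_map => i; rewrite mnm_tnth.
have uL : uniq L by rewrite sort_uniq enum_uniq.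
have sL : size L = n by rewrite size_sort size_enum_ord.
have srt : sorted (relpre m geq) L.
  by apply: sort_sorted => x y; apply: leq_total.
pose D := [set a in take #|C| L].
have cD : #|D| = #|C|.
  rewrite cardsE (card_uniqP _) ?take_uniq // size_takel // sL.
  by rewrite -[leqRHS]card_ord max_card.
have -> : sumn (take #|C| (mpart m)) = \sum_(a in D) m a.
  rewrite eL -map_take sumnE big_map big_uniq ?take_uniq //=.
  by apply: eq_bigl => a; rewrite inE.
have topD a b : a \in D -> b \notin D -> m b <= m a.
  rewrite !inE => aD bD.
  have : b \in drop #|C| L.
    have : b \in L by rewrite mem_sort mem_enum.
    by rewrite -{1}(cat_take_drop #|C| L) mem_cat (negbTE bD).
  move: srt; rewrite -{1}(cat_take_drop #|C| L) sorted_pairwise; last first.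
    by move=> x y z /= yx zy; apply: leq_trans zy yx.
  rewrite pairwise_cat => /andP[/allrelP H _] bL; exact: H.
by apply/anti_leq/andP; split; apply: leq_sum_top; rewrite ?cD.
Qed.

(* The order in which the variables of [m] appear when its exponents are
   sorted: by decreasing exponent, then by increasing index. *)
Definition before m (a b : 'I_n) : bool :=
  (m b < m a) || (m a == m b) && (a < b).

Lemma before_irr m a : before m a a = false.
Proof. by rewrite /before !ltnn andbF. Qed.

Lemma before_trans m : transitive (before m).
Proof. by move=> b a c; rewrite /before; lia. Qed.

Lemma before_total m a b : a != b -> before m a b || before m b a.
Proof. by rewrite /before -(inj_eq val_inj) /=; lia. Qed.

Definition nbefore m (a : 'I_n) : nat := #|[set b | before m b a]|.

Lemma nbefore_lt m a : nbefore m a < n.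
Proof.
rewrite -[X in _ < X]card_ord -cardsT; apply: proper_card.
by apply/properP; split; [exact: subsetT | exists a; rewrite ?inE ?before_irr].
Qed.

Definition mrank m (a : 'I_n) : 'I_n := Ordinal (nbefore_lt m a).

Lemma mrank_lt m a b : before m a b -> mrank m a < mrank m b.
Proof.
move=> ab; apply: proper_card; apply/properP; split.
  by apply/subsetP => c; rewrite !inE => ca; apply: before_trans ab.
by exists a; rewrite inE // before_irr.
Qed.

Lemma mrankE m a b : (mrank m a < mrank m b) = before m a b.
Proof.
apply/idP/idP => [ab|]; last exact: mrank_lt.
have ne : a != b by apply: contraTneq ab => ->; rewrite ltnn.
by case/orP: (before_total m ne) => // /mrank_lt; rewrite ltnNge (ltnW ab).
Qed.

Lemma mrank_inj m : injective (mrank m).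
Proof.
move=> a b e; apply/eqP; apply: contraT => /(before_total m).
by rewrite -!mrankE e ltnn.
Qed.

Lemma card_mrank_lt m i : i <= n -> #|[set a | mrank m a < i]| = i.
Proof.
move=> le_in.
rewrite -(card_imset _ (@mrank_inj m)) -[RHS](@card_ord i).
rewrite -[RHS](card_image (f := widen_ord le_in)); last first.
  by move=> x y /(congr1 val) /= /val_inj.
apply: eq_card => x; apply/imsetP/imageP => [[a]|[y _ ->]].
  rewrite inE => ai ->; exists (Ordinal ai) => //; exact: val_inj.
have [g gK gE] := injF_bij (@mrank_inj m).
by exists (g (widen_ord le_in y)); rewrite ?inE gE /=.
Qed.

(** The comparison is [before] after lowering exponents by 2 on [T], with the 2 moved to the other
    side to avoid truncated subtraction. *)
Definition reducing m T : bool :=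
  [&& T != set0, [forall a in T, 2 <= m a] &
    [forall a in T, forall b in ~: T,
       (m b + 2 < m a) || (m b + 2 == m a) && (a < b)]].

Definition irreducible m : bool := [forall T, ~~ reducing m T].

Lemma reducingP m T : reflect
  [/\ T != set0, forall a, a \in T -> 2 <= m a &
    forall a b, a \in T -> b \notin T ->
       (m b + 2 < m a) || (m b + 2 == m a) && (a < b)]
  (reducing m T).
Proof.
apply: (iffP and3P) => [[h0 /forall_inP h1 /forall_inP h2]|[h0 h1 h2]]; split=> //.
- by move=> a b aT bT; have /forall_inP := h2 a aT; apply; rewrite inE.
- exact/forall_inP.
- apply/forall_inP => a aT; apply/forall_inP => b; rewrite inE; exact: h2.
Qed.

(** If no exponent is [t + 1] or [t + 2], the variables of exponent at least [t + 3] form a reducing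
    set. *)
Lemma irreducible_gap m t a : irreducible m -> t + 3 <= m a ->
  exists b, t < m b < t + 3.
Proof.
move=> /forallP irr ta; apply/existsP; apply: contraT => /existsPn none.
have /negP[] := irr [set c | t + 3 <= m c]; apply/reducingP; split.
- by apply/set0Pn; exists a; rewrite inE.
- by move=> c; rewrite inE; lia.
- by move=> c d; rewrite !inE; have := none d; lia.
Qed.

Lemma irreducible_low m (a : 'I_n) : irreducible m -> exists b, m b <= 1.
Proof.
move=> /forallP irr; apply/existsP; apply: contraT => /existsPn none.
have /negP[] := irr setT; apply/reducingP; split.
- by apply/set0Pn; exists a; rewrite inE.
- by move=> c _; have := none c; lia.
- by move=> c d _; rewrite inE.
Qed.

Definition mcode m : {perm 'I_n} * {ffun 'I_n -> bool} :=
  (perm (@mrank_inj m), [ffun a => odd (m a)]).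

(** At the last variable, in the common order, where the exponents differ, equal parities force a
    difference of at least 2; the variables up to it then reduce the monomial with the larger
    exponent there. *)
Lemma mcode_inj m1 m2 :
  irreducible m1 -> irreducible m2 -> mcode m1 = mcode m2 -> m1 = m2.
Proof.
move=> irr1 irr2 [/permP er /ffunP ep].
have {}er a : mrank m1 a = mrank m2 a by have := er a; rewrite !permE.
have {}ep a : odd (m1 a) = odd (m2 a) by have := ep a; rewrite !ffunE.
have bE a b : before m1 a b = before m2 a b by rewrite -!mrankE !er.
apply/mnmP => a0; apply/eqP; apply: contraT => ne0.
case: (arg_maxnP (P := fun a => m1 a != m2 a) (mrank m1) ne0) => a nea amax.
have agree b : before m1 a b -> m1 b = m2 b.
  rewrite -mrankE => lt; apply/eqP; apply: contraT => /amax.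
  by rewrite /= ltnNge in lt *; move=> h; rewrite h in lt.
wlog lt12 : m1 m2 er ep bE irr1 irr2 {ne0 amax} nea agree / m1 a < m2 a.
  move=> W; have [|lt|e] := ltngtP (m1 a) (m2 a); last by rewrite e eqxx in nea.
    exact: W.
  apply: (W m2 m1) => //; first by rewrite eq_sym.
  by move=> b; rewrite -bE => /agree.
have le2 : m1 a + 2 <= m2 a.
  rewrite leqNgt; apply/negP => lt; have := ep a.
  by have -> : m2 a = (m1 a).+1; [lia | rewrite /=; case: odd].
have /forallP/(_ [set c | ~~ before m2 a c])/negP[] := irr2.
apply/reducingP; split.
- by apply/set0Pn; exists a; rewrite inE before_irr.
- by move=> c; rewrite inE /before; lia.
- move=> c d; rewrite !inE negbK => ca; rewrite -bE => ad.
  by have := agree d ad; move: ca ad; rewrite /before; lia.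
Qed.

End Combinatorics.

(** * Dominance and the exchange of squares *)

Section Reduction.
Variable n : nat.
Implicit Types (m : 'X_{1..n}) (T A : {set 'I_n}) (la mu : seq nat).

Lemma dominated_refl la : dominated la la.
Proof. by []. Qed.

Lemma dominated_trans mu la nu :
  dominated mu la -> dominated la nu -> dominated mu nu.
Proof.
case=> e1 h1 [e2 h2]; split=> [|i]; first by rewrite e1.
exact: leq_trans (h1 i) (h2 i).
Qed.

(** An integer strictly increasing for dominance between lists of equal length; inductions on
    dominance run on it. *)
Definition psums la : nat := \sum_(i < (size la).+1) sumn (take i la).

Lemma psums_dominated mu la : size mu = size la ->
  dominated mu la -> mu <> la -> psums mu < psums la.
Proof.
move=> es [_ dom] ne; rewrite /psums es ltn_neqAle leq_sum // andbT.
apply/eqP => e; case: ne.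
have {e} e i : i <= size la -> sumn (take i mu) = sumn (take i la).
  move=> le_i; have [_] := leqif_sum (fun (i : 'I_(size la).+1) (_ : true) =>
    leqif_eq (dom i)).
  rewrite [in LHS]e eqxx => /esym/forallP H.
  by have /eqP := H (Ordinal (le_i : i < (size la).+1)).
apply: (@eq_from_nth _ 0) => // i; rewrite es => lt_i.
have := e _ lt_i; rewrite (take_nth 0) ?es // (take_nth 0 lt_i) !sumn_rcons.
by rewrite e ?(ltnW lt_i) // => /addnI.
Qed.

Lemma sum_mpart m (f : nat -> nat) :
  \sum_(v <- mpart m) f v = \sum_a f (m a).
Proof.
rewrite (perm_big m) /=; last by rewrite /mpart perm_sort.
by rewrite big_tuple; apply: eq_bigr => i _; rewrite mnm_tnth.
Qed.

(** Second induction measure: for a fixed type, it is smaller when large exponents sit at large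
    indices. *)
Definition idxweight m : nat := \sum_a m a * (n - a).

(** For [#|A| = #|T|], these are the monomials of e_|T| of the squares times the quotient of [m] by
    the squares over [T]. *)
Definition mexchange m T A : 'X_{1..n} :=
  [multinom m a - 2 * (a \in T) + 2 * (a \in A) | a < n].

Lemma sum_mem A (C : {set _}) : \sum_(a in C) (a \in A : nat) = #|C :&: A|.
Proof.
rewrite -sum1_card big_mkcond [RHS]big_mkcond; apply: eq_bigr => a _.
by rewrite inE; case: (a \in C); case: (a \in A).
Qed.

Section Exchange.
Variables (m : 'X_{1..n}) (T : {set 'I_n}).
Hypothesis redT : reducing m T.

Let m' (a : 'I_n) := m a - 2 * (a \in T).

Lemma mexchange_self : mexchange m T T = m.
Proof.
apply/mnmP => a; rewrite mnmE; have [_ H _] := reducingP _ _ redT.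
by have := H a; case: (a \in T) => [/(_ isT)|_]; lia.
Qed.

Lemma sum_mexchange A (C : {set _}) :
  \sum_(a in C) mexchange m T A a = \sum_(a in C) m' a + 2 * #|C :&: A|.
Proof.
rewrite -sum_mem big_distrr /= -big_split /=.
by apply: eq_bigr => a _; rewrite mnmE.
Qed.

(** The front [i] variables of [m] maximise both parts of the sum: the lowered exponents stay sorted
    in the order of [m], and [T] is an initial segment of that order, hence nested with these
    variables. *)
Lemma mexchange_dominated A :
  #|A| = #|T| -> dominated (mpart (mexchange m T A)) (mpart m).
Proof.
move=> cA; have deg : mdeg (mexchange m T A) = mdeg m.
  rewrite -[in RHS]mexchange_self !mdegE.
  have E B : \sum_i mexchange m T B i = \sum_(i in setT) mexchange m T B i.
    by apply: eq_bigl => i; rewrite inE.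
  by rewrite !E !sum_mexchange !setTI cA.
split=> [|i]; first by rewrite !sumn_mpart.
have [le_in|lt_ni] := leqP i n; last first.
  by rewrite !take_oversize ?size_mpart ?(ltnW lt_ni) // !sumn_mpart deg.
pose C := [set a | mrank (mexchange m T A) a < i].
pose D := [set a | mrank m a < i].
have [_ red2 redlt] := reducingP _ _ redT.
have topC a b : a \in C -> b \notin C -> mexchange m T A b <= mexchange m T A a.
  rewrite !inE -leqNgt => aC bC; have := leq_trans aC bC.
  by rewrite mrankE /before; lia.
have befD a b : a \in D -> b \notin D -> before m a b.
  by rewrite !inE -leqNgt => aD bD; rewrite -mrankE; apply: leq_trans bD.
have topD a b : a \in D -> b \notin D -> m b <= m a.
  by move=> aD bD; have := befD a b aD bD; rewrite /before; lia.
have := sumn_take_mpart topC; have := sumn_take_mpart topD.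
rewrite !card_mrank_lt // => -> ->.
rewrite -[in leqRHS]mexchange_self !sum_mexchange.
apply: leq_add.
  apply: leq_sum_top => [|a b aD bD]; first by rewrite !card_mrank_lt.
  have := befD a b aD bD; rewrite /before /m'.
  have := red2 a; have := redlt a b; have := redlt b a.
  by case: (a \in T); case: (b \in T) => /=; rewrite ?muln0 ?subn0; lia.
rewrite leq_mul2l /=.
have [sDT|/subsetPn[a aD aT]] := boolP (D \subset T).
  rewrite (setIidPl sDT); apply: leq_trans (subset_leq_card (subsetIl _ _)) _.
  by rewrite !card_mrank_lt.
suff /setIidPr -> : T \subset D by rewrite -cA subset_leq_card // subsetIr.
apply/subsetP => t tT; apply: contraT => tD.
have := befD a t aD tD; have := redlt t a tT aT; rewrite /before; lia.
Qed.

(** When the type does not change, [A] and [T] carry the same sum of lowered exponents, so [T] wins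
    through its indices alone. *)
Lemma mexchange_idxweight A : #|A| = #|T| -> A != T ->
  mpart (mexchange m T A) = mpart m -> idxweight (mexchange m T A) < idxweight m.
Proof.
move=> cA neA ep; have [_ red2 redlt] := reducingP _ _ redT.
(* The sum of the squared exponents only depends on the type, so it forces [A]
   and [T] to have the same sum of exponents. *)
have sqE B : \sum_a (mexchange m T B a) ^ 2 =
    \sum_a m' a ^ 2 + 4 * \sum_(a in B) m' a + 4 * #|B|.
  rewrite -sum1_card [\sum_(a in B) m' a]big_mkcond [\sum_(a in B) 1]big_mkcond.
  rewrite !big_distrr /= -!big_split /=; apply: eq_bigr => a _.
  by rewrite mnmE -/(m' a); case: (a \in B); rewrite ?muln0 ?addn0 //; lia.
have eqS : \sum_(a in A) m' a = \sum_(a in T) m' a.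
  have := sum_mpart (mexchange m T A) (fun v => v ^ 2).
  rewrite ep sum_mpart -[in LHS]mexchange_self !sqE cA; lia.
(* Since [n - a] is below [n.+1], this weight compares lowered exponents first and indices
   second. *)
have := @ltn_sum_top _ (fun a : 'I_n => m' a * n.+1 + (n - a)) A T cA neA.
rewrite !big_split /= -!big_distrl /= eqS ltn_add2l => H.
have wE B : idxweight (mexchange m T B) =
    \sum_a m' a * (n - a) + 2 * \sum_(a in B) (n - a).
  rewrite [\sum_(a in B) _]big_mkcond big_distrr /= -big_split /=.
  apply: eq_bigr => a _.
  by rewrite mnmE -/(m' a) mulnDl; case: (a \in B); rewrite ?muln0.
rewrite -[in X in _ < X]mexchange_self !wE ltn_add2l ltn_mul2l /=.
apply: H => a b aT bT.
have := red2 a aT; rewrite /m' aT (negbTE bT) muln0 subn0 muln1 => ma2.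
have [an bn] := (ltn_ord a, ltn_ord b).
have /orP[lt|/andP[/eqP <- ab]] := redlt a b aT bT; last first.
  by rewrite addnK ltn_add2l; lia.
apply: (@leq_trans ((m b).+1 * n.+1)); first by rewrite mulSn; lia.
by apply: leq_trans (leq_addr _ _); rewrite leq_mul2r; apply/orP; right; lia.
Qed.

End Exchange.
End Reduction.

(** * Types of irreducible monomials *)

Section Types.
Variable n : nat.
Implicit Types (m : 'X_{1..n}) (S : {set 'I_n.-1} * {set 'I_n}).

Lemma card_ge (N i : nat) (A : {set 'I_N}) (f : nat -> nat) :
  (forall j : 'I_N, f j = (j \in A)) ->
  #|[set j in A | i <= j]| = \sum_(i <= j < N) f j.
Proof.
move=> fA; rewrite big_geq_mkord -sum1_card big_mkcond [RHS]big_mkcond /=.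
apply: eq_bigr => j _; rewrite inE fA.
by case: (j \in A); case: (i <= j).
Qed.

Lemma nth_lambdaS S (i : 'I_n) :
  nth 0 (lambdaS S) i = 2 * #|[set j in S.1 | i <= j]| + (i \in S.2).
Proof. by rewrite nth_mktuple. Qed.

(** Double counting: [j] in [S.1] adds 2 to each of the first [j.+1] entries. *)
Lemma sumn_lambdaS S :
  sumn (lambdaS S) = 2 * (\sum_(j in S.1) j.+1) + #|S.2|.
Proof.
rewrite sumnE big_map big_enum /=.
rewrite big_split /= -big_distrr /=; congr (2 * _ + _); last first.
  by rewrite -sum1_card [RHS]big_mkcond; apply: eq_bigr => i _; case: (i \in _).
under eq_bigr => i _ do rewrite -sum1_card.
rewrite (exchange_big_dep (mem S.1)) /= => [|i j _]; last by rewrite inE => /andP[].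
apply: eq_bigr => j jS; rewrite sum1_card.
have le_jn : j.+1 <= n by have := ltn_ord j; lia.
rewrite -[RHS](@card_ord j.+1) -(card_image (f := widen_ord le_jn)); last first.
  by move=> x y /(congr1 val) /= /val_inj.
apply: eq_card => i; rewrite -[LHS]/(j \in [set k in S.1 | i <= k]) inE jS /=.
apply/idP/imageP => [ij|[y _ ->]].
  by exists (Ordinal (ij : i < j.+1)) => //; apply: val_inj.
by have := ltn_ord y.
Qed.

(** Parities of the entries give [S.2]; the counts from [j] and from [j.+1] differ by the membership
    of [j] in [S.1]. *)
Lemma lambdaS_inj S S' : lambdaS S = lambdaS S' -> S = S'.
Proof.
move=> e; have E (i : 'I_n) : 2 * #|[set j in S.1 | i <= j]| + (i \in S.2) =
    2 * #|[set j in S'.1 | i <= j]| + (i \in S'.2).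
  by rewrite -!nth_lambdaS e.
case: S S' {e} E => [A B] [A' B'] /= E.
have EB (i : 'I_n) : (i \in B) = (i \in B').
  by have := E i; case: (i \in B); case: (i \in B'); lia.
have EA (i : 'I_n) : #|[set j in A | i <= j]| = #|[set j in A' | i <= j]|.
  by have := E i; rewrite EB => /addIn/eqP; rewrite eqn_mul2l => /eqP.
congr (_, _); apply/setP => // j.
have lt_jn : j < n by have := ltn_ord j; lia.
have lt_jn1 : j.+1 < n by have := ltn_ord j; lia.
have split_j (X : {set 'I_n.-1}) :
    #|[set k in X | j <= k]| = (j \in X) + #|[set k in X | j.+1 <= k]|.
  rewrite (cardsD1 j) inE leqnn andbT; congr (_ + _); apply: eq_card => k.
  rewrite !inE -(inj_eq val_inj) /= ltn_neqAle eq_sym.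
  by case: (k \in X); rewrite ?andbF.
have := EA (Ordinal lt_jn); have /= e1 := EA (Ordinal lt_jn1).
rewrite /= !split_j e1 => /addIn.
by case: (j \in A); case: (j \in A').
Qed.

(** [S.2] marks the odd entries and [S.1] the descents of the halved entries; this recovers the type
    because the halves end at 0 and drop by at most 1 at each step. *)
Lemma irreducible_lambdaS m : irreducible m ->
  exists2 S, @admissible n (mdeg m) S & lambdaS S = mpart m :> seq nat.
Proof.
move=> irr; pose la i := nth 0 (mpart m) i; pose h i := (la i)./2.
have sz := size_mpart m.
have anti i j : i <= j < n -> la j <= la i.
  have geq_trans : transitive geq by move=> x y z yx zy; apply: leq_trans zy yx.
  case/andP=> ij jn; apply: (sorted_leq_nth geq_trans leqnn 0 (sorted_mpart m)).
  - by rewrite inE sz (leq_ltn_trans ij).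
  - by rewrite inE sz.
  - exact: ij.
have valP a : exists2 j, j < n & m a = la j.
  have : m a \in mpart m by rewrite mem_mpart; apply/existsP; exists a.
  by case/(nthP 0) => j jn <-; exists j; rewrite -?sz.
have lastP : h n.-1 = 0.
  (* For [n = 0] there is no variable and the entry is the default 0. *)
  rewrite /h /la; case: (posnP n) => [n0|n_gt0].
    by rewrite nth_default // sz n0.
  have [b] := irreducible_low (Ordinal n_gt0) irr; have [j jn ->] := valP b.
  by have := anti j n.-1; rewrite /la; lia.
have stepP i : i < n.-1 -> h i.+1 <= h i <= h i.+1 + 1.
  move=> lt_i; have mono := anti i i.+1; rewrite -/(la i) -/(la i.+1) in mono.
  have {}mono : la i.+1 <= la i by apply: mono; lia.
  apply/andP; split; first by rewrite /h; lia.
  (* A drop of 2 in the halves is a drop of at least 3 in the exponents; irreducibility then puts an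
     exponent strictly between two consecutive sorted entries. *)
  rewrite leqNgt; apply/negP => lt; have gap : la i.+1 + 3 <= la i.
    by move: lt; rewrite /h; lia.
  have /existsP[a /eqP ai] : [exists a, m a == la i].
    by rewrite -mem_mpart mem_nth // sz; lia.
  rewrite -ai in gap; have [b] := irreducible_gap irr gap.
  have [j jn ->] := valP b; have [ij|ji] := ltnP i j.
    by have := anti i.+1 j; lia.
  by have := anti j i; lia.
pose S : {set 'I_n.-1} * {set 'I_n} :=
  ([set j : 'I_n.-1 | h j != h j.+1], [set i : 'I_n | odd (la i)]).
have cardS (i : 'I_n) : #|[set j in S.1 | i <= j]| = h i.
  rewrite (card_ge i (f := fun j => h j - h j.+1)); last first.
    by move=> j; rewrite inE; have := stepP j (ltn_ord j); case: eqP; lia.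
  have le_i : i <= n.-1 by have := ltn_ord i; lia.
  (* The sum telescopes down to [h n.-1 = 0]; monotonicity of [h] keeps the truncated differences
     exact. *)
  have tel j : i <= j <= n.-1 -> \sum_(j <= k < n.-1) (h k - h k.+1) = h j.
    move=> /andP[_]; move: {2}(n.-1 - j) (erefl (n.-1 - j)) => d.
    elim: d j => [|d IHd] j ed le_j.
      by rewrite big_geq; [have -> : j = n.-1 by lia | lia].
    rewrite big_ltn; last by lia.
    by rewrite IHd; [have := stepP j; lia | lia | lia].
  by rewrite tel // leqnn.
have eS : lambdaS S = mpart m :> seq nat.
  apply: (@eq_from_nth _ 0) => [|i]; rewrite size_tuple ?sz // => lt_i.
  rewrite (nth_lambdaS S (Ordinal lt_i)) cardS inE /= -/(la i) /h.
  by rewrite mul2n addnC odd_double_half.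
exists S => //; rewrite /admissible eS sorted_mpart -sumn_lambdaS eS.
by rewrite sumn_mpart eqxx.
Qed.

End Types.

Local Open Scope ring_scope.

(** * Straightening modulo the ideal *)

Section Straightening.
Variable n : nat.
Local Notation P := {mpoly rat[n]}.
Implicit Types (m : 'X_{1..n}) (D : 'X_{1..n} -> Prop) (p q : P).

Definition inI p : Prop := p \in @IB_pred n.

Lemma inI0 : inI 0.
Proof. by have [] := IB_submod n. Qed.

Lemma inI_lin a p q : inI p -> inI q -> inI (a *: p + q).
Proof. by have [_ H] := IB_submod n; apply: H. Qed.

Lemma inID p q : inI p -> inI q -> inI (p + q).
Proof. by rewrite -{2}[p]scale1r; apply: inI_lin. Qed.

Lemma inIZ a p : inI p -> inI (a *: p).
Proof. by move=> pI; rewrite -[_ *: _]addr0; apply: inI_lin inI0. Qed.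

Lemma inIN p : inI p -> inI (- p).
Proof. by rewrite -scaleN1r; apply: inIZ. Qed.

Lemma inIB p q : inI p -> inI q -> inI (p - q).
Proof. by move=> pI /inIN; apply: inID. Qed.

Lemma inI_sum (I : Type) (r : seq I) (Q : pred I) (F : I -> P) :
  (forall i, Q i -> inI (F i)) -> inI (\sum_(i <- r | Q i) F i).
Proof. by move=> FI; elim/big_ind: _; [exact: inI0 | exact: inID |]. Qed.

Lemma inI_gen p q : IB_gen q -> inI (p * q).
Proof.
move=> gq; apply/asboolP; exists [:: (p, q)]; last by rewrite big_seq1.
by move=> c; rewrite inE => /eqP ->.
Qed.

Definition supp_in D p : Prop := forall m, p@_m != 0 -> D m.

Lemma supp_in0 D : supp_in D 0.
Proof. by move=> m; rewrite mcoeff0 eqxx. Qed.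

Lemma supp_in_lin D a p q : supp_in D p -> supp_in D q -> supp_in D (a *: p + q).
Proof.
move=> Dp Dq m; rewrite mcoeffD mcoeffZ.
have [pm|/Dp //] := eqVneq p@_m 0.
by rewrite pm mulr0 add0r => /Dq.
Qed.

Lemma supp_inD D p q : supp_in D p -> supp_in D q -> supp_in D (p + q).
Proof. by rewrite -{2}[p]scale1r; apply: supp_in_lin. Qed.

Lemma supp_inZ D a p : supp_in D p -> supp_in D (a *: p).
Proof. by move=> Dp; rewrite -[_ *: _]addr0; apply: supp_in_lin Dp (supp_in0 D). Qed.

Lemma supp_inB D p q : supp_in D p -> supp_in D q -> supp_in D (p - q).
Proof. by move=> Dp Dq; rewrite -scaleN1r addrC; apply: supp_in_lin. Qed.

Lemma supp_in_sum D (I : Type) (r : seq I) (Q : pred I) (F : I -> P) :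
  (forall i, Q i -> supp_in D (F i)) -> supp_in D (\sum_(i <- r | Q i) F i).
Proof. by move=> FD; elim/big_ind: _; [exact: supp_in0 | exact: supp_inD |]. Qed.

Lemma supp_inX D m : D m -> supp_in D 'X_[m].
Proof.
by move=> Dm m2; rewrite mcoeffX; have [<-|] := eqVneq m m2; rewrite // eqxx.
Qed.

Lemma supp_in_sub D1 D2 p :
  (forall m, D1 m -> D2 m) -> supp_in D1 p -> supp_in D2 p.
Proof. by move=> sD pD m /pD /sD. Qed.

Lemma supp_in_and D1 D2 p :
  supp_in D1 p -> supp_in D2 p -> supp_in (fun m => D1 m /\ D2 m) p.
Proof. by move=> h1 h2 m pm; split; [apply: h1 | apply: h2]. Qed.

Lemma supp_in_homog k p : supp_in (fun m => mdeg m = k) p <-> p \is k.-homog.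
Proof.
split=> [pD|/dhomogP h m]; last by rewrite -mcoeff_msupp => /h.
by apply/dhomogP => m; rewrite mcoeff_msupp => /pD.
Qed.

Lemma comp_mpolyX_Xsq m :
  'X_[m] \mPo Xsq n = 'X_[[multinom (2 * m i)%N | i < n]] :> P.
Proof.
rewrite comp_mpolyX mpolyXE_id; apply: eq_bigr => i _.
by rewrite tnth_mktuple -exprM mnmE.
Qed.

Lemma comp_mpoly_Xsq_homog d p :
  p \is d.-homog -> (p \mPo Xsq n) \is (2 * d)%N.-homog.
Proof.
move=> /dhomogP hp; rewrite (mpolyE p) raddf_sum big_seq; apply: rpred_sum => m mp.
rewrite /= linearZ /= comp_mpolyX_Xsq; apply: rpredZ.
rewrite dhomogX -(hp _ mp) /= !mdegE big_distrr /=; apply/eqP.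
by apply: eq_bigr => i _; rewrite mnmE.
Qed.

Lemma mcoeff0_comp_Xsq p : (p \mPo Xsq n)@_0%MM = p@_0%MM.
Proof.
rewrite {1}(mpolyE p) [_ \mPo _]raddf_sum /= [_@__]raddf_sum [in RHS](mpolyE p).
rewrite [RHS]raddf_sum; apply: eq_bigr => m _.
rewrite /= linearZ /= !mcoeffZ comp_mpolyX_Xsq !mcoeffX; congr (_ * (nat_of_bool _)%:R).
apply/eqP/eqP => [|->]; last by apply/mnmP => i; rewrite mnmE mnm0E.
by move=> /mnmP e; apply/mnmP => i; have := e i; rewrite mnmE mnm0E; lia.
Qed.

Lemma mesym_IB_gen j : (0 < j)%N -> IB_gen (mesym n rat j \mPo Xsq n).
Proof.
move=> j_gt0; split; last by exists (mesym n rat j); rewrite ?mesym_sym.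
rewrite mcoeff0_comp_Xsq; have := dhomog_mesym n rat j.
by move=> /dhomog_nemf_coeff; apply; rewrite /= mdeg0 eq_sym -lt0n.
Qed.

Lemma mesym_sq_exchange m (T : {set 'I_n}) : reducing m T ->
  'X_[[multinom (m a - 2 * (a \in T))%N | a < n]] * (mesym n rat #|T| \mPo Xsq n)
  = \sum_(A : {set 'I_n} | #|A| == #|T|) 'X_[mexchange m T A].
Proof.
move=> redT; rewrite mesymE raddf_sum mulr_sumr /=; apply: eq_bigr => A _.
rewrite comp_mpolyX_Xsq -mpolyXD; congr 'X_[_].
by apply/mnmP => i; rewrite !mnmE.
Qed.

(** Induction on [psums], then on [idxweight]: a reducing set makes [m] congruent to minus the sum
    of the other exchanged monomials, for which one of the two measures has dropped. *)
Lemma straighten_monomial m : exists y : P,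
  supp_in (fun m2 => irreducible m2 /\ dominated (mpart m2) (mpart m)) y
  /\ inI ('X_[m] - y).
Proof.
have [N] := ubnP (psums (mpart m)); elim: N m => // N IHN m leN.
have [M] := ubnP (idxweight m); elim: M m leN => // M IHM m leN leM.
have [irr|] := boolP (irreducible m).
  exists 'X_[m]; rewrite subrr; split; last exact: inI0.
  by apply: supp_inX; split=> //; apply: dominated_refl.
rewrite negb_forall => /existsP[T]; rewrite negbK => redT.
have ex (A : {set _}) : exists y : P, #|A| = #|T| -> A != T ->
    supp_in (fun m2 => irreducible m2 /\ dominated (mpart m2) (mpart m)) y
    /\ inI ('X_[mexchange m T A] - y).
  case: (eqVneq #|A| #|T|) => [cA|ne]; last by exists 0 => /eqP; rewrite (negbTE ne).
  case: (eqVneq A T) => [->|neA]; first by exists 0.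
  have dom := mexchange_dominated redT cA.
  have [y [yD yI]] : exists y : P,
    supp_in (fun m2 => irreducible m2 /\
      dominated (mpart m2) (mpart (mexchange m T A))) y
    /\ inI ('X_[mexchange m T A] - y).
    case: (eqVneq (mpart (mexchange m T A)) (mpart m)) => [e|ne].
      apply: IHM; first by rewrite e.
      exact: leq_trans (mexchange_idxweight redT cA neA e) _.
    apply: IHN; apply: leq_trans (psums_dominated _ dom _) _ => //.
      by rewrite !size_mpart.
    exact/eqP.
  exists y => _ _; split=> //; apply: supp_in_sub yD => m2 [irr2 dom2].
  by split=> //; apply: dominated_trans dom.
have [Y YP] := fin_all_exists ex.
exists (- \sum_(A : {set 'I_n} | (#|A| == #|T|) && (A != T)) Y A); split.
  rewrite -sub0r; apply: supp_inB; first exact: supp_in0.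
  by apply: supp_in_sum => A /andP[/eqP cA neA]; have [] := YP A cA neA.
have := inI_gen 'X_[[multinom (m a - 2 * (a \in T))%N | a < n]]
  (mesym_IB_gen (j := #|T|) _).
have /and3P[T0 _ _] := redT; rewrite card_gt0 => /(_ T0).
rewrite mesym_sq_exchange // (bigD1 T) //= mexchange_self // => gI.
have -> : 'X_[m] - - \sum_(A : {set 'I_n} | (#|A| == #|T|) && (A != T)) Y A =
   ('X_[m] + \sum_(A : {set 'I_n} | (#|A| == #|T|) && (A != T)) 'X_[mexchange m T A])
   - \sum_(A : {set 'I_n} | (#|A| == #|T|) && (A != T)) ('X_[mexchange m T A] - Y A) :> P.
  by rewrite sumrB opprK opprB -[RHS]addrA [X in _ = _ + X]addrCA subrr addr0.
apply: inIB => //; apply: inI_sum => A /andP[/eqP cA neA].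
by have [] := YP A cA neA.
Qed.

Lemma straighten D p : supp_in D p -> exists y : P,
  supp_in (fun m => irreducible m /\
    exists2 m2, D m2 & dominated (mpart m) (mpart m2)) y
  /\ inI (p - y).
Proof.
move=> pD; have [f fP] := boolp.choice straighten_monomial.
exists (\sum_(m <- msupp p) p@_m *: f m); split.
  rewrite big_seq; apply: supp_in_sum => m; rewrite mcoeff_msupp => /pD Dm.
  apply: supp_inZ; have [+ _] := fP m; apply: supp_in_sub => m2 [irr dom].
  by split=> //; exists m.
rewrite {1}[p]mpolyE -sumrB; apply: inI_sum => m _.
by rewrite -scalerBr; apply: inIZ; have [] := fP m.
Qed.

End Straightening.

(** * Independence of irreducible monomials, by evaluation on an orbit *)

Section Orbit.
Variable n : nat.
Local Notation P := {mpoly rat[n]}.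
Implicit Types (m : 'X_{1..n}) (p q y : P).

Local Notation Omega := ({perm 'I_n} * {ffun 'I_n -> bool})%type.
Implicit Types w : Omega.

(** The orbit of (1, ..., n) under signed permutations, indexed by the codomain of [mcode] so that
    points and codes are equinumerous. *)
Definition orbit_pt w : 'I_n -> rat := fun i => (-1) ^+ (w.2 i) * (w.1 i).+1%:R.

Lemma orbit_pt_inj w1 w2 : orbit_pt w1 =1 orbit_pt w2 -> w1 = w2.
Proof.
case: w1 w2 => [s1 e1] [s2 e2] e; have es : s1 = s2.
  apply/permP => i; apply: val_inj; have := congr1 Num.norm (e i).
  by rewrite /orbit_pt /= !normrMsign !normr_nat => /eqP; rewrite eqr_nat eqSS => /eqP.
rewrite -es in e *; congr (_, _); apply/ffunP => i; apply: (@signr_inj rat).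
by have /mulIf := e i; apply; rewrite /= pnatr_eq0.
Qed.

(** Lagrange interpolation: the product of the [D w'] over [w' != w] vanishes on the orbit except at
    the point of [w]. *)
Lemma orbit_interpolation (u : Omega -> rat) :
  exists p, forall w, p.@[orbit_pt w] = u w.
Proof.
(* A sum of squares, hence zero at no rational point other than [orbit_pt w]. *)
pose D w : P := \sum_(i < n) ('X_i - (orbit_pt w i)%:MP) ^+ 2.
have DE w w' : (D w).@[orbit_pt w'] = \sum_i (orbit_pt w' i - orbit_pt w i) ^+ 2.
  rewrite /D raddf_sum /=; apply: eq_bigr => i _.
  by rewrite rmorphXn /= mevalB mevalXU mevalC.
have D0 w : (D w).@[orbit_pt w] = 0.
  by rewrite DE big1 // => i _; rewrite subrr expr0n.
have Dn0 w w' : w != w' -> (D w).@[orbit_pt w'] != 0.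
  apply: contraNneq; rewrite DE => /psumr_eq0P H; apply/eqP.
  apply: orbit_pt_inj => i; apply/esym/eqP; rewrite -subr_eq0 -sqrf_eq0.
  by apply/eqP/H => // j _; apply: sqr_ge0.
pose L w : P := \prod_(w' | w' != w) D w'.
exists (\sum_w (u w / (L w).@[orbit_pt w]) *: L w) => w.
rewrite raddf_sum (bigD1 w) //= big1 ?addr0 => [|w' ne]; rewrite mevalZ.
  rewrite divfK // rmorph_prod /=; apply/prodf_neq0 => w' ne; exact: Dn0.
rewrite [X in _ * X](_ : _ = 0) ?mulr0 //.
rewrite rmorph_prod; apply/eqP/prodf_eq0; exists w; first by rewrite eq_sym.
by rewrite /= D0.
Qed.

Lemma meval_msym (s : 'S_n) p (v : 'I_n -> rat) :
  (msym s p).@[v] = p.@[fun i => v (s i)].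
Proof.
rewrite -(comp_mpoly_id (msym s p)) msym_mPo comp_mpoly_meval.
by apply: meval_eq => i; rewrite !tnth_mktuple mevalXU.
Qed.

Lemma sym_sq_orbit p w : p \is symmetric ->
  (p \mPo Xsq n).@[orbit_pt w] = p.@[fun i => i.+1%:R ^+ 2].
Proof.
move=> /issymP/(_ w.1) sp; rewrite -[in RHS]sp meval_msym comp_mpoly_meval.
apply: meval_eq => i; rewrite tnth_mktuple rmorphXn /= mevalXU.
by rewrite /orbit_pt exprMn sqrr_sign mul1r.
Qed.

(** On the orbit, the degree [d] part of [p] in the squares is a constant [c d], so a term of degree
    [e + 2 * d = k] drops to degree [e]; the case [d = 0] is excluded since [p] has no constant
    term. *)
Lemma ideal_homog_orbit_gen k q p : p \is symmetric -> p@_0%MM = 0 ->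
  exists h, supp_in (fun m => mdeg m < k)%N h /\
  forall w, (pihomog mdeg k (q * (p \mPo Xsq n))).@[orbit_pt w] = h.@[orbit_pt w].
Proof.
move=> symp p0.
pose c d := (pihomog mdeg d p).@[fun i => i.+1%:R ^+ 2].
exists (\sum_(e < msize q) \sum_(d < msize p | ((e + 2 * d == k) && (0 < d))%N)
   c d *: pihomog mdeg e q); split.
  apply: supp_in_sum => e _; apply: supp_in_sum => d /andP[/eqP <- d0].
  apply: supp_inZ; have := pihomogP mdeg e q => /supp_in_homog.
  by apply: supp_in_sub => m ->; lia.
move=> w.
rewrite {1}(pihomog_partitionE (leqnn (msize q))).
rewrite {1}(pihomog_partitionE (leqnn (msize p))).
rewrite [_ \mPo _]raddf_sum /= mulr_suml [pihomog _ _ _]raddf_sum.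
rewrite [LHS]raddf_sum [RHS]raddf_sum /=; apply: eq_bigr => e _.
rewrite mulr_sumr [pihomog _ _ (\sum_(i < _) _)]raddf_sum [LHS]raddf_sum [RHS]raddf_sum.
rewrite [RHS]big_mkcond /=; apply: eq_bigr => d _.
have hom : pihomog mdeg e q * (pihomog mdeg d p \mPo Xsq n) \is (e + 2 * d)%N.-homog.
  by apply: dhomogM; rewrite ?pihomogP // comp_mpoly_Xsq_homog // pihomogP.
have [ek|ne] := eqVneq (e + 2 * d)%N k; last by rewrite (pihomog_ne0 ne hom) meval0.
rewrite -ek (pihomog_dE hom) /= mevalM mevalZ sym_sq_orbit ?pihomog_sym // -/(c d).
have [d0|] := posnP d; last by rewrite mulrC.
suff -> : c d = 0 by rewrite mulr0.
rewrite /c d0 pihomogE big1 ?meval0 // => m.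
by rewrite mdeg_eq0 => /eqP ->; rewrite p0 scale0r.
Qed.

Lemma ideal_homog_orbit k p : inI p -> p \is k.-homog ->
  exists h, supp_in (fun m => mdeg m < k)%N h /\
  forall w, p.@[orbit_pt w] = h.@[orbit_pt w].
Proof.
(* Writing [p] as its own degree [k] component allows the products to be treated one by one, though
   they need not be homogeneous. *)
move=> /asboolP[r rI ->] hom; rewrite -(pihomog_dE hom) {hom}.
elim: r rI => [|[q g] r IHr] rI.
  by exists 0; rewrite big_nil pihomog0; split=> //; apply: supp_in0.
have [|h [hk hE]] := IHr; first by move=> c cr; apply: rI; rewrite inE cr orbT.
have [g0 [s syms gE]] := rI (q, g) (mem_head _ _).
have s0 : s@_0%MM = 0 by rewrite -mcoeff0_comp_Xsq -gE.
have [h2 [h2k h2E]] := ideal_homog_orbit_gen k q syms s0.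
exists (h2 + h); split; first exact: supp_inD.
by move=> w; rewrite big_cons pihomogD !mevalD /= hE -h2E -gE.
Qed.

(** Straightening a monomial leaves a homogeneous error in the ideal, equal on the orbit to a
    polynomial of smaller degree, to which induction applies. *)
Lemma orbit_irreducible K p : supp_in (fun m => mdeg m < K)%N p ->
  exists y, supp_in (fun m => irreducible m /\ mdeg m < K)%N y /\
  forall w, p.@[orbit_pt w] = y.@[orbit_pt w].
Proof.
elim: K p => [|K IHK] p pK.
  exists 0; split=> [|w]; first exact: supp_in0.
  suff -> : p = 0 by [].
  apply/mpolyP => m; rewrite mcoeff0; apply/eqP; apply: contraT => /pK.
  by rewrite ltn0.
have ex m : exists y, (mdeg m < K.+1)%N ->
    supp_in (fun m2 => irreducible m2 /\ mdeg m2 < K.+1)%N y /\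
    forall w, 'X_[m].@[orbit_pt w] = y.@[orbit_pt w].
  have [mK|] := boolP (mdeg m < K.+1)%N; last by exists 0.
  have [y [yD yI]] := straighten_monomial m.
  have ydeg : supp_in (fun m2 => mdeg m2 = mdeg m) y.
    by apply: supp_in_sub yD => m2 [_ []]; rewrite !sumn_mpart.
  have hom : ('X_[m] - y : P) \is (mdeg m).-homog.
    by apply/supp_in_homog; apply: supp_inB => //; apply: supp_inX.
  have [h [hD hE]] := ideal_homog_orbit yI hom.
  have [|z [zD zE]] := IHK h; first by apply: supp_in_sub hD => m2 /leq_trans; apply.
  exists (y + z) => _; split.
    apply: supp_inD.
      apply: supp_in_sub (supp_in_and ydeg yD) => m2 [-> [? _]]; split=> //.
    by apply: supp_in_sub zD => m2 [? ?]; split=> //; lia.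
  by move=> w; rewrite mevalD -zE -hE mevalB addrC subrK.
have [f fP] := boolp.choice ex.
exists (\sum_(m <- msupp p) p@_m *: f m); split=> [|w].
  rewrite big_seq; apply: supp_in_sum => m; rewrite mcoeff_msupp => /pK mK.
  by apply: supp_inZ; have [] := fP m mK.
rewrite {1}[p]mpolyE !raddf_sum big_seq [RHS]big_seq; apply: eq_bigr => m.
rewrite mcoeff_msupp => /pK mK /=; rewrite !mevalZ.
by have [_ ->] := fP m mK.
Qed.

Lemma mcode_dec w : exists o : option 'X_{1..n},
  (forall m, irreducible m -> mcode m = w -> o = Some m) /\
  (forall m, o = Some m -> irreducible m /\ mcode m = w).
Proof.
have [[m [irr mw]]|none] := pselect (exists m, irreducible m /\ mcode m = w).
  exists (Some m); split=> [m2 irr2 e|m2 [<-]] //.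
  by congr Some; apply: mcode_inj; rewrite ?mw.
by exists None; split=> // m irr mw; case: none; exists m.
Qed.

(** A dimension count: the square matrix [M] holds the values of irreducible monomials on the orbit,
    with zero rows at codes not attained. Interpolation gives it full rank, so values determine
    coefficients. *)
Lemma orbit_vanish y : supp_in (fun m => irreducible m) y ->
  (forall w, y.@[orbit_pt w] = 0) -> y = 0.
Proof.
move=> yirr y0; have [dec decP] := boolp.choice mcode_dec.
pose row_of (z : P) : 'rV[rat]_#|{: Omega}| :=
  \row_i (if dec (enum_val i) is Some m then z@_m else 0).
pose M : 'M[rat]_#|{: Omega}| := \matrix_(i, j)
  (if dec (enum_val i) is Some m then ('X_[m] : P).@[orbit_pt (enum_val j)] else 0).
have rowE z j : supp_in (fun m => irreducible m) z ->
    (row_of z *m M) 0 j = z.@[orbit_pt (enum_val j)].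
  move=> zirr; set v := orbit_pt _.
  rewrite mxE [z in RHS]mpolyE raddf_sum /=.
  rewrite (partition_big (@mcode n) predT) //=.
  rewrite [RHS](reindex (@enum_val _ predT)) /=; last exact/onW_bij/enum_val_bij.
  apply: eq_bigr => i _; rewrite !mxE.
  have [dec1 dec2] := decP (enum_val i).
  case e : (dec (enum_val i)) => [m|]; last first.
    rewrite mul0r big1_seq // => m /andP[/eqP mi].
    by rewrite mcoeff_msupp => /zirr irr; rewrite (dec1 m irr mi) in e.
  have [irr mi] := dec2 m e.
  have eqm m2 : m2 \in msupp z -> (mcode m2 == enum_val i) = (m2 == m).
    rewrite mcoeff_msupp => /zirr irr2.
    by apply/eqP/eqP => [mi2|->] //; apply: mcode_inj; rewrite // mi2.
  rewrite big_seq_cond (eq_bigl (fun m2 => (m2 \in msupp z) && (m2 == m))); last first.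
    by move=> m2; case: (boolP (m2 \in _)) => //= /eqm.
  rewrite -big_seq_cond; have [mz|mz] := boolP (m \in msupp z).
    rewrite big_mkcond (bigD1_seq m) ?msupp_uniq //= eqxx big1 ?addr0 ?mevalZ //.
    by move=> m2 /negbTE ->.
  rewrite (memN_msupp_eq0 mz) mul0r big1_seq // => m2 /andP[/eqP -> mz2].
  by rewrite mz2 in mz.
have full : row_full M.
  have ex (i : 'I_#|{: Omega}|) : exists u : 'rV_#|{: Omega}|, u *m M = delta_mx 0 i.
    have [p pE] := orbit_interpolation (fun w => (w == enum_val i)%:R).
    have [|z [zD zE]] := @orbit_irreducible (msize p) p.
      by move=> m; rewrite -mcoeff_msupp; apply: msize_mdeg_lt.
    exists (row_of z); apply/rowP => j; rewrite rowE.
      by rewrite -zE pE mxE eqxx /= (inj_eq enum_val_inj).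
    by apply: supp_in_sub zD => m [].
  have [U UE] := fin_all_exists ex.
  apply/row_fullP; exists (\matrix_i U i); apply/row_matrixP => i.
  by rewrite row_mul rowK UE row1.
have /row_fullP[B /mulmx1C MB] := full.
have yM : row_of y *m M = 0 by apply/rowP => j; rewrite rowE // y0 mxE.
have r0 : row_of y = 0 by rewrite -[LHS]mulmx1 -MB mulmxA yM mul0mx.
apply/mpolyP => m; rewrite mcoeff0; apply/eqP; apply: contraT => ym.
have irr := yirr m ym; have [dec1 _] := decP (mcode m).
have := congr1 (fun u : 'rV_#|{: Omega}| => u 0 (enum_rank (mcode m))) r0.
by rewrite !mxE enum_rankK (dec1 m) // => /eqP; rewrite (negbTE ym).
Qed.

(** On the orbit [y] equals an irreducible combination [z] of degree below [k]; independence gives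
    [y = z], and degrees force both to vanish. *)
Lemma irreducible_free k y : supp_in (fun m => irreducible m) y -> y \is k.-homog ->
  inI y -> y = 0.
Proof.
move=> yirr yk yI; have [h [hk hE]] := ideal_homog_orbit yI yk.
have [z [zD zE]] := orbit_irreducible hk.
have /eqP : y - z = 0.
  apply: orbit_vanish; last by move=> w; rewrite mevalB hE zE subrr.
  by apply: supp_inB => //; apply: supp_in_sub zD => m [].
rewrite subr_eq0 => /eqP e; apply/mpolyP => m; rewrite mcoeff0.
apply/eqP; apply: contraT => ym; have /supp_in_homog/(_ m ym) degm := yk.
by rewrite e in ym; have [_] := zD m ym; rewrite degm ltnn.
Qed.

End Orbit.

(** * Averaging a linear map over the group *)

Section Average.
Variables (gT : finGroupType) (M N : gModule rat gT) (f : M -> N).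
Hypothesis f_linear : linear f.

(** Reynolds operator: the mean of the conjugates of [f], which is equivariant. *)
Definition gaverage (u : M) : N :=
  #|gT|%:R^-1 *: \sum_(g : gT) gact N (f (gact M u g)) g^-1%g.

Lemma gaverage_linear : linear gaverage.
Proof.
move=> a u v; rewrite /gaverage scalerA mulrC -scalerA -scalerDr; congr (_ *: _).
rewrite scaler_sumr -big_split; apply: eq_bigr => g _ /=.
by rewrite gactD gactZ f_linear gactD gactZ.
Qed.

Lemma gact_sum (I : Type) (r : seq I) (F : I -> N) g :
  gact N (\sum_(i <- r) F i) g = \sum_(i <- r) gact N (F i) g.
Proof. exact: (big_morph (fun x => gact N x g) (@gactD _ _ N g) (gact0 N g)). Qed.

Lemma gaverage_act g u : gaverage (gact M u g) = gact N (gaverage u) g.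
Proof.
rewrite /gaverage gactZ gact_sum; congr (_ *: _).
rewrite [RHS](reindex_inj (mulgI g)) /=; apply: eq_bigr => h _.
by rewrite -gactM -[in RHS]gactM invMg mulgKV.
Qed.

Lemma card_gT_neq0 : #|gT|%:R != 0 :> rat.
Proof. by rewrite pnatr_eq0 -lt0n; apply/card_gt0P; exists 1%g. Qed.
End Average.

(** * Coordinates of a direct sum *)

Section DirectSumCoordinates.
Variables (K : fieldType) (gT : finGroupType) (I : finType).
Variable M : I -> gModule K gT.

Definition coord (i : I) (v : gsum M) : M i := (v : gsum_type M) i.

Lemma coordP (v w : gsum M) : (forall i, coord i v = coord i w) -> v = w.
Proof. by move=> e; apply/ffunP. Qed.

Lemma coord_linear i : linear (coord i).
Proof. by move=> a v w; rewrite /coord [LHS]ffunE; congr (_ + _); rewrite ffunE. Qed.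

HB.instance Definition _ i :=
  GRing.isLinear.Build K (gsum M) (M i) _ (coord i) (coord_linear i).

Lemma coord_act i v g : coord i (gact (gsum M) v g) = gact (M i) (coord i v) g.
Proof. by rewrite /coord [LHS]ffunE. Qed.
End DirectSumCoordinates.

(** * Parts of a given type and their classes in the subquotients *)

Section Modules.
Variable n : nat.
Local Notation P := {mpoly rat[n]}.
Implicit Types (m : 'X_{1..n}) (p q x y z : P) (la : seq nat).

Lemma gproj_inI p q : gproj (IB n) p = gproj (IB n) q <-> inI (p - q).
Proof. by split=> [/eqP|pq]; [rewrite gproj_eq | apply/eqP; rewrite gproj_eq]. Qed.

Lemma mem_Pspan (D : seq nat -> Prop) p :
  (p \in (Pspan n D)) <-> supp_in (fun m => D (mpart m)) p.
Proof.
split=> [|pD].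
  move=> /asboolP[r rS ->]; rewrite big_seq; apply: supp_in_sum => c cr.
  by apply: supp_inZ; have [m Dm ->] := rS c cr; apply: supp_inX.
apply/asboolP; exists [seq (p@_m, 'X_[m] : PB n) | m <- msupp p].
  move=> c /mapP[m mp ->]; exists m => //; apply: pD; by rewrite -mcoeff_msupp.
by rewrite big_map {1}[p]mpolyE.
Qed.

Lemma linear_eq_supp (V : lmodType rat) (f g : P -> V) p :
  linear f -> linear g -> (forall m, m \in msupp p -> f 'X_[m] = g 'X_[m]) ->
  f p = g p.
Proof.
have l0 (h : P -> V) : linear h -> h 0 = 0.
  by move=> hl; rewrite -[X in h X](addNr 0) -scaleN1r hl scaleN1r addNr.
move=> fl gl fg; rewrite [p in LHS]mpolyE [p in RHS]mpolyE.
elim: (msupp p) fg => [|m s IHs] fg; first by rewrite !big_nil !l0.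
rewrite !big_cons fl gl fg ?mem_head // IHs // => m2 m2s.
by apply: fg; rewrite inE m2s orbT.
Qed.

Definition tpart la p : P := \sum_(m <- msupp p | mpart m == la) p@_m *: 'X_[m].

Lemma mcoeff_tpart la p m : (tpart la p)@_m = if mpart m == la then p@_m else 0.
Proof.
rewrite /tpart raddf_sum /=; under eq_bigr => i _ do rewrite mcoeffZ mcoeffX.
have [mp|mp] := boolP (m \in msupp p).
  rewrite big_mkcond (bigD1_seq m) ?msupp_uniq //= eqxx mulr1.
  rewrite [X in _ + X]big1 ?addr0 // => m2 /negbTE ->.
  by rewrite mulr0 if_same.
rewrite (memN_msupp_eq0 mp) if_same big1_seq // => m2 /andP[_ m2p].
case: eqP => [e|_]; last by rewrite mulr0.
by rewrite -e m2p in mp.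
Qed.

Lemma tpart_linear la : linear (tpart la).
Proof.
move=> a p q; apply/mpolyP => m; rewrite mcoeffD mcoeffZ !mcoeff_tpart.
by case: ifP; rewrite ?mcoeffD ?mcoeffZ ?mulr0 ?addr0.
Qed.

HB.instance Definition _ la :=
  GRing.isLinear.Build rat P P _ (tpart la) (tpart_linear la).

Lemma tpartX la m : tpart la 'X_[m] = if mpart m == la then 'X_[m] else 0.
Proof.
apply/mpolyP => m2; rewrite mcoeff_tpart mcoeffX (fun_if (mcoeff m2)) mcoeff0 mcoeffX.
by have [->|_] := eqVneq m m2; rewrite // !if_same.
Qed.

Lemma supp_tpart la p : supp_in (fun m => mpart m = la) (tpart la p).
Proof. by move=> m; rewrite mcoeff_tpart; case: ifP => [/eqP|_]; rewrite ?eqxx. Qed.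

Lemma tpart_id la p : supp_in (fun m => mpart m = la) p -> tpart la p = p.
Proof.
move=> pD; apply/mpolyP => m; rewrite mcoeff_tpart.
by case: eqP => // ne; apply/esym/eqP; apply: contraT => /pD.
Qed.

Lemma tpart_eq0 la p : supp_in (fun m => mpart m <> la) p -> tpart la p = 0.
Proof.
move=> pD; apply/mpolyP => m; rewrite mcoeff_tpart mcoeff0.
by case: eqP => // e; apply/eqP; apply: contraT => /pD.
Qed.

Lemma tpart_act la p (g : Bn n) : tpart la (Pact p g) = Pact (tpart la p) g.
Proof.
have X m : tpart la (Pact 'X_[m] g) = Pact (tpart la 'X_[m]) g.
  have [c e] := PactX m g; rewrite tpartX e linearZ /= tpartX mpart_perm.
  by case: ifP => _; rewrite ?e // scaler0 /Pact raddf0.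
apply: (linear_eq_supp (f := fun q => tpart la (Pact q g))
  (g := fun q => Pact (tpart la q) g)) => [a q r|a q r|m _].
- by rewrite Pact_linear linearP.
- by rewrite linearP Pact_linear.
- exact: X.
Qed.

Lemma supp_dom_tpart la p : supp_in (fun m => dominated (mpart m) la) p ->
  supp_in (fun m => sdominated (mpart m) la) (p - tpart la p).
Proof.
move=> pD m; rewrite mcoeffB mcoeff_tpart; case: ifP => [_|/eqP ne].
  by rewrite subrr eqxx.
by rewrite subr0 => /pD.
Qed.

Lemma supp_tpart_dom la p : supp_in (fun m => dominated (mpart m) la) (tpart la p).
Proof. by apply: supp_in_sub (@supp_tpart la p) => m ->. Qed.

Lemma gproj_tpart_mem la p :
  gproj (IB n) (tpart la p) \in gimage (IB n) (Pspan n (dominated^~ la)).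
Proof.
apply/asboolP; exists (tpart la p) => //.
exact/mem_Pspan/supp_tpart_dom.
Qed.

(** Extracting the part of type [la] first makes this linear on all polynomials. When all types in
    [p] are dominated by [la], it is the class of [p] itself, the rest being strictly dominated. *)
Definition rclass la p : RBpart n la :=
  @gproj _ _ (gsub (gimage (IB n) (Pspan n (dominated^~ la)))) _
    (GSub (gproj_tpart_mem la p)).

Lemma rclass_eq la p q : rclass la p = rclass la q <->
  exists2 z, supp_in (fun m => sdominated (mpart m) la) z &
    inI (tpart la p - tpart la q - z).
Proof.
split=> [/eqP|[z zD zI]].
  rewrite gproj_eq => /asboolP[z /mem_Pspan zD /= e]; exists z => //.
  by apply/gproj_inI; rewrite gprojB.
apply/eqP; rewrite gproj_eq; apply/asboolP; exists z; first exact/mem_Pspan.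
by rewrite /= -gprojB; apply/gproj_inI.
Qed.

Lemma rclass_linear la : linear (rclass la).
Proof.
move=> a p q; rewrite /rclass -gprojZ -gprojD; congr gproj.
by apply: val_inj; rewrite /= -gprojZ -gprojD linearP.
Qed.

HB.instance Definition _ la :=
  GRing.isLinear.Build rat P (RBpart n la) _ (rclass la) (rclass_linear la).

Lemma rclass_act la p (g : Bn n) :
  rclass la (Pact p g) = gact (RBpart n la) (rclass la p) g.
Proof.
rewrite [RHS]gproj_act; congr gproj; apply: val_inj => /=.
by rewrite gproj_act tpart_act.
Qed.

Lemma rclass_congr la p q :
  supp_in (fun m => dominated (mpart m) la) p ->
  supp_in (fun m => dominated (mpart m) la) q ->
  inI (p - q) -> rclass la p = rclass la q.
Proof.
move=> pD qD pqI; apply/rclass_eq.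
exists ((q - tpart la q) - (p - tpart la p)).
  by apply: supp_inB; apply: supp_dom_tpart.
suff -> : tpart la p - tpart la q - (q - tpart la q - (p - tpart la p)) = p - q by [].
by ring.
Qed.

Lemma rclass_eq0 la p : supp_in (fun m => mpart m <> la) p -> rclass la p = 0.
Proof.
move=> pD; rewrite -(linear0 (rclass la)); apply/rclass_eq.
exists 0; first exact: supp_in0.
by rewrite tpart_eq0 // linear0 !subr0; apply: inI0.
Qed.

Lemma rclass_surj la (r : RBpart n la) :
  exists2 p, supp_in (fun m => mpart m = la) p & rclass la p = r.
Proof.
rewrite -(gproj_repr r); case: (repr r) => u uU.
have /asboolP[p /mem_Pspan pD e] := uU.
exists (tpart la p); first exact: supp_tpart.
apply/eqP; rewrite gproj_eq; apply/asboolP; exists (tpart la p - p).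
  apply/mem_Pspan; rewrite -opprB -sub0r; apply: supp_inB; first exact: supp_in0.
  exact: supp_dom_tpart.
by rewrite /= e tpart_id ?gprojB //; apply: supp_tpart.
Qed.

(** * Normal forms in degree [k] *)

Variable k : nat.

Lemma gproj_pihomog_mem p :
  gproj (IB n) (pihomog mdeg k p) \in gimage (IB n) (@Phomog n k).
Proof. by apply/asboolP; exists (pihomog mdeg k p); rewrite // [_ \in _]pihomogP. Qed.

Definition hclass p : RBk n k := GSub (gproj_pihomog_mem p).

Lemma hclass_linear : linear hclass.
Proof.
by move=> a p q; apply: val_inj; rewrite /= -gprojZ -gprojD linearP.
Qed.

HB.instance Definition _ :=
  GRing.isLinear.Build rat P (RBk n k) _ hclass hclass_linear.

Lemma hclass_eq p q : p \is k.-homog -> q \is k.-homog ->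
  hclass p = hclass q <-> inI (p - q).
Proof.
move=> pk qk; rewrite -gproj_inI; split=> [/(congr1 val)|e].
  by rewrite /= !pihomog_dE.
by apply: val_inj; rewrite /= !pihomog_dE.
Qed.

Lemma hclass_surj (u : RBk n k) : exists2 p, p \is k.-homog & hclass p = u.
Proof.
case: u => u uU; have /asboolP[p pk e] := uU.
by exists p => //; apply: val_inj; rewrite /= pihomog_dE.
Qed.

Lemma hclass_act p (g : Bn n) : p \is k.-homog ->
  Pact p g \is k.-homog /\ hclass (Pact p g) = gact (RBk n k) (hclass p) g.
Proof.
move=> pk; have pgk : Pact p g \is k.-homog := Phomog_stable g pk.
split=> //; apply: val_inj; rewrite /= !pihomog_dE //.
by rewrite [RHS]gproj_act.
Qed.

Lemma normal_form_ex (u : RBk n k) : exists y,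
  [/\ supp_in (fun m => irreducible m) y, y \is k.-homog & hclass y = u].
Proof.
have [p pk <-] := hclass_surj u.
have /supp_in_homog/straighten[y [yD yI]] := pk.
have yk : y \is k.-homog.
  apply/supp_in_homog; apply: supp_in_sub yD => m [_ [m2 <- [+ _]]].
  by rewrite !sumn_mpart.
exists y; split=> //; first by apply: supp_in_sub yD => m [].
by apply/esym/hclass_eq.
Qed.

Definition normal_form (u : RBk n k) : P := sval (cid (normal_form_ex u)).

Lemma normal_formP u :
  [/\ supp_in (fun m => irreducible m) (normal_form u),
      normal_form u \is k.-homog & hclass (normal_form u) = u].
Proof. by rewrite /normal_form; case: cid. Qed.

Lemma normal_form_uniq u y : supp_in (fun m => irreducible m) y ->
  y \is k.-homog -> hclass y = u -> normal_form u = y.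
Proof.
move=> yirr yk yu; have [nirr nk nu] := normal_formP u.
apply/eqP; rewrite -subr_eq0; apply/eqP; apply: (@irreducible_free _ k).
- exact: supp_inB.
- exact: rpredB.
- by apply/hclass_eq; rewrite // nu.
Qed.

Lemma normal_form_linear : linear normal_form.
Proof.
move=> a u v; have [uirr uk uE] := normal_formP u.
have [virr vk vE] := normal_formP v.
apply: normal_form_uniq; first exact: supp_in_lin.
  by apply: rpredD => //; apply: rpredZ.
by rewrite linearP /= uE vE.
Qed.

(** Straightening [p] stays below [la] and yields an irreducible representative, which is the normal
    form by uniqueness. *)
Lemma normal_form_dominated la p :
  p \is k.-homog -> supp_in (fun m => dominated (mpart m) la) p ->
  supp_in (fun m => dominated (mpart m) la) (normal_form (hclass p)) /\
  inI (p - normal_form (hclass p)).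
Proof.
move=> pk pD; have /supp_in_homog pk' := pk.
have [y [yD yI]] := straighten (supp_in_and pk' pD).
have yk : y \is k.-homog.
  apply/supp_in_homog; apply: supp_in_sub yD => m [_ [m2 [<- _] [+ _]]].
  by rewrite !sumn_mpart.
rewrite (@normal_form_uniq _ y) //; first last.
- by apply/esym/hclass_eq.
- by apply: supp_in_sub yD => m [].
split=> //; apply: supp_in_sub yD => m [_ [m2 [_ dom2] dom]].
exact: dominated_trans dom2.
Qed.

(** * The equivariant splitting and its bijectivity *)

Local Notation index := {S : {set 'I_n.-1} * {set 'I_n} | admissible k S}.
Local Notation target := (gsum (fun S : index => RBpart n (lambdaS (val S)))).

(** Irreducible monomials are not permuted by the action, as ties are broken by index; equivariance
    comes from averaging this map. *)
Definition split_nf (u : RBk n k) : target :=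
  [ffun S : index => rclass (lambdaS (val S)) (normal_form u)] : gsum_type _.

Lemma coord_split_nf S u :
  coord S (split_nf u) = rclass (lambdaS (val S)) (normal_form u).
Proof. by rewrite /coord ffunE. Qed.

Lemma split_nf_linear : linear split_nf.
Proof.
move=> a u v; apply: coordP => S.
by rewrite linearP /= !coord_split_nf normal_form_linear linearP.
Qed.

Definition splitting : RBk n k -> target := gaverage split_nf.

HB.instance Definition _ := GRing.isLinear.Build rat (RBk n k) target _
  splitting (gaverage_linear split_nf_linear).

Lemma normal_form_act la p (g : Bn n)
    (q := normal_form (gact (RBk n k) (hclass p) g)) :
  p \is k.-homog -> supp_in (fun m => dominated (mpart m) la) p ->
  [/\ supp_in (fun m => dominated (mpart m) la) (Pact p g),
      supp_in (fun m => dominated (mpart m) la) q & inI (Pact p g - q)].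
Proof.
move=> pk pD; rewrite /q; have [pgk <-] := hclass_act g pk.
have pgD : supp_in (fun m => dominated (mpart m) la) (Pact p g).
  apply/(@mem_Pspan (dominated^~ la)).
  by apply: (@gsub_stable _ _ _ (Pspan n _) g); apply/mem_Pspan.
by have [] := normal_form_dominated pgk pgD.
Qed.

Lemma coord_splitting S u : coord S (splitting u) =
  #|Bn n|%:R^-1 *: \sum_(g : Bn n) gact (RBpart n (lambdaS (val S)))
     (rclass (lambdaS (val S)) (normal_form (gact (RBk n k) u g))) g^-1%g.
Proof.
rewrite /splitting /gaverage linearZ raddf_sum; congr (_ *: _).
by apply: eq_bigr => g _; rewrite /= coord_act coord_split_nf.
Qed.

(** All terms of the average agree: the normal form of [Pact p g] is congruent to it and still below
    the index type, so has the same class, which [g^-1] brings back to that of [p]. *)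
Lemma coord_splitting_diag S p : p \is k.-homog ->
  supp_in (fun m => dominated (mpart m) (lambdaS (val S))) p ->
  coord S (splitting (hclass p)) = rclass (lambdaS (val S)) p.
Proof.
move=> pk pD; rewrite coord_splitting.
rewrite (eq_bigr (fun _ => rclass (lambdaS (val S)) p)) => [|g _].
  rewrite sumr_const -scaler_nat scalerA mulVf ?scale1r //.
  exact: card_gT_neq0.
have [pgD qD qI] := normal_form_act g pk pD.
by rewrite -(rclass_congr pgD qD qI) rclass_act -gactM mulgV gact1.
Qed.

(** Normal forms of translates of [p] only involve types dominated by [la], so the index type does
    not occur. *)
Lemma coord_splitting_eq0 S la p : p \is k.-homog ->
  supp_in (fun m => dominated (mpart m) la) p ->
  ~ dominated (lambdaS (val S)) la -> coord S (splitting (hclass p)) = 0.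
Proof.
move=> pk pD ndom; rewrite coord_splitting big1 ?scaler0 // => g _.
have [_ qD _] := normal_form_act g pk pD.
rewrite rclass_eq0 ?gact0 //; apply: supp_in_sub qD => m dom e.
by case: ndom; rewrite -e.
Qed.

(** In the normal form of a nonzero kernel element, take a monomial [m] of largest [psums]. By
    triangularity the coordinate at its type only sees the part of that type, which must then be a
    combination of irreducible monomials strictly below, against independence. *)
Lemma splitting_inj : injective splitting.
Proof.
apply: raddf_inj => u; have [yirr yk yu] := normal_formP u.
move: (normal_form u) yirr yk yu => y yirr yk <- {u} y0.
suff -> : y = 0 by rewrite linear0.
apply/eqP; rewrite -msupp_eq0; apply: contraT.
move=> /(seq_argmax (fun m => psums (mpart m)))[m]; rewrite mcoeff_msupp => ym mmax.
have mk : mdeg m = k by have /supp_in_homog/(_ m ym) := yk.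
have [S] := irreducible_lambdaS (yirr m ym); rewrite mk => admS laE.
pose S0 : index := exist _ S admS.
have coordX m2 : m2 \in msupp y ->
    coord S0 (splitting (hclass 'X_[m2])) = rclass (lambdaS S) 'X_[m2].
  move=> m2y; have m2k : ('X_[m2] : P) \is k.-homog.
    rewrite dhomogX; apply/eqP; rewrite mcoeff_msupp in m2y.
    by have /supp_in_homog/(_ m2 m2y) := yk.
  have m2D : supp_in (fun m => dominated (mpart m) (mpart m2)) 'X_[m2].
    by apply: supp_inX.
  have [e|ne] := eqVneq (mpart m2) (lambdaS S : seq nat).
    by rewrite (@coord_splitting_diag S0) //= -e.
  (* A type strictly above that of [m] would have larger [psums]. *)
  rewrite (@coord_splitting_eq0 S0 (mpart m2)) //=; last first.
    rewrite laE => dom; have := mmax m2 m2y; rewrite leqNgt.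
    rewrite psums_dominated ?size_mpart //.
    by move=> e; rewrite laE e eqxx in ne.
  by rewrite rclass_eq0 //; apply: supp_inX; apply/eqP.
have ry0 : rclass (lambdaS S) y = 0.
  transitivity (coord S0 (splitting (hclass y))); last by rewrite y0 linear0.
  pose G p : RBpart n (lambdaS S) := coord S0 (splitting (hclass p)).
  apply: (linear_eq_supp (g := G)) => [|a p q|m2 m2y].
  - exact: rclass_linear.
  - by rewrite /G hclass_linear [splitting _]gaverage_linear ?coord_linear //;
      apply: split_nf_linear.
  - exact/esym/coordX.
have : rclass (lambdaS S) y = rclass (lambdaS S) 0 by rewrite ry0 linear0.
move=> /rclass_eq[z zD]; rewrite linear0 subr0 laE => zI.
(* Straightening [z] stays strictly below the type of [m] and makes independence applicable. *)
have [z2 [z2D z2I]] := straighten zD; rewrite laE in z2D.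
have /eqP : tpart (mpart m) y - z2 = 0.
  apply: (@irreducible_free _ k).
  - apply: supp_inB; last by apply: supp_in_sub z2D => m2 [].
    by move=> m2; rewrite mcoeff_tpart; case: ifP; rewrite ?eqxx // => _ /yirr.
  - apply/supp_in_homog; apply: supp_inB.
      move=> m2; rewrite mcoeff_tpart; case: ifP; rewrite ?eqxx // => _.
      by have /supp_in_homog := yk; apply.
    apply: supp_in_sub z2D => m2 [_ [m3 [[+ _] _] [+ _]]].
    by rewrite !sumn_mpart mk => <- ->.
  by rewrite -(subrKA z); apply: inID.
rewrite subr_eq0 => /eqP e; have : z2@_m != 0 by rewrite -e mcoeff_tpart eqxx.
move=> /z2D[_ [m2 [dom2 ne] dom]].
have le_m : (psums (mpart m) <= psums (mpart m2))%N.
  case: (eqVneq (mpart m) (mpart m2)) => [->//|/eqP ne2]; apply: ltnW.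
  by apply: psums_dominated; rewrite ?size_mpart.
have : (psums (mpart m2) < psums (mpart m))%N.
  by apply: psums_dominated; rewrite ?size_mpart.
by rewrite ltnNge le_m.
Qed.

(** Triangular elimination by decreasing [psums]: coordinates at the current level are lifted and
    subtracted, which leaves the other coordinates at or above this level unchanged. *)
Lemma splitting_surj v : exists u, splitting u = v.
Proof.
pose rk (S : index) := psums (lambdaS (val S)).
suff vanish N w : (forall S, (N <= rk S)%N -> coord S w = 0) ->
    exists u, splitting u = w.
  apply: (vanish (\max_S rk S).+1) => S; rewrite ltnNge.
  by rewrite (leq_bigmax_cond (F := rk)).
elim: N w => [|N IHN] w w0.
  by exists 0; rewrite linear0; apply: coordP => S; rewrite w0 // linear0.
have ex S : exists p, supp_in (fun m => mpart m = lambdaS (val S)) p /\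
    rclass (lambdaS (val S)) p = coord S w.
  by have [p pD pE] := rclass_surj (coord S w); exists p.
have [x xP] := fin_all_exists ex.
have xk S : x S \is k.-homog.
  apply/supp_in_homog; have [xD _] := xP S; apply: supp_in_sub xD => m e.
  by rewrite -sumn_mpart e sumn_lambdaS; case/andP: (valP S) => _ /eqP.
have xdom S : supp_in (fun m => dominated (mpart m) (lambdaS (val S))) (x S).
  by have [xD _] := xP S; apply: supp_in_sub xD => m ->.
pose u := \sum_(S | rk S == N) hclass (x S).
have [|u' u'E] := IHN (w - splitting u); last first.
  by exists (u' + u); rewrite linearD /= u'E subrK.
have coordE S : coord S (splitting u) =
    \sum_(S' | rk S' == N) coord S (splitting (hclass (x S'))).
  by rewrite /u !raddf_sum.
move=> S leNS; rewrite linearB /= coordE.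
(* Were the type of [S] dominated by that of [S'], its [psums] would be below [N]. *)
have off S' : rk S' == N -> S' != S -> coord S (splitting (hclass (x S'))) = 0.
  move=> /eqP rS' neS; apply: coord_splitting_eq0 (xk S') (@xdom S') _ => dom.
  have := leNS; rewrite -rS' leqNgt psums_dominated ?size_tuple //.
  by move=> /val_inj/lambdaS_inj/val_inj e; rewrite e eqxx in neS.
have [rS|neN] := eqVneq (rk S) N; last first.
  rewrite w0; last by rewrite ltn_neqAle eq_sym neN.
  rewrite big1 ?subrr // => S' rS'; apply: off => //.
  by apply: contraNneq neN => <-.
rewrite (bigD1 S) ?rS //= big1 ?addr0; last by move=> S' /andP[]; apply: off.
by rewrite coord_splitting_diag //; have [_ ->] := xP S; rewrite subrr.
Qed.

Lemma splitting_act (g : Bn n) u :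
  splitting (gact (RBk n k) u g) = gact target (splitting u) g.
Proof. exact: gaverage_act. Qed.

End Modules.

Theorem theorem5p8 (n k : nat) (hk : (k <= n ^ 2)%N) :
  gModule_iso (RBk n k)
    (gsum (fun S : {S : {set 'I_n.-1} * {set 'I_n} | admissible k S} =>
             RBpart n (lambdaS (val S)))).
Proof.
exists (@splitting n k : {linear _ -> _}); last exact: splitting_act.
have [inv invK] := boolp.choice (@splitting_surj n k).
by exists inv => // u; apply: splitting_inj; rewrite invK.
Qed.
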